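(* Let $d\geq 2$ and let $\mathcal{S}\subset\mathbb{R}^d$ be a finite set with weights $a(s)\geq 0$ ($s\in\mathcal{S}$) satisfying $\sum_{s\in\mathcal{S}}a(s)=1$ and $\sum_{s\in\mathcal{S}}a(s)s=0$, whose covariance matrix $\mathrm{cov}$ is positive definite. Let $C=\mathrm{cov}^{-\frac12}(\mathbb{R}_+^d)$. (i) If there exists an $\mathrm{a}^+$-polynomial on $\mathbb{R}_+^d$ for the discrete Laplacian $L_{\mathcal{S}}$, then $C$ is a Weyl chamber of a finite Coxeter group. (ii) Conversely, if $d=2$ and $C=\mathrm{cov}^{-\frac12}(\mathbb{R}_+^2)$ is a Weyl chamber of a finite Coxeter group (i.e., if the interior angle of $C$ has the form $\pi/n$ for some positive integer $n$), then there exists an $\mathrm{a}^+$-polynomial on $\mathbb{R}_+^2$ for $L_{\mathcal{S}}$.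
   Context: Here $\mathbb{R}_+=[0,\infty)$ and $s=(s_1,\dots,s_d)$ are the coordinates of $s$ in the canonical basis. The covariance matrix is normalized to have unit diagonal: $\mathrm{cov}=\left(\frac{\sum_{s}a(s)s_is_j}{\sqrt{\sum_s a(s)s_i^2}\,\sqrt{\sum_s a(s)s_j^2}}\right)_{1\leq i,j\leq d}$. It is symmetric, and $\mathrm{cov}^{-\frac12}$ denotes the inverse of its positive definite square root. The discrete Laplacian is $L_{\mathcal{S}}(f)(x)=\sum_{s\in\mathcal{S}}a(s)f(x+s)-f(x)$ for $f:\mathbb{R}^d\to\mathbb{R}$. A function $f$ is discrete harmonic on $D$ if $L_{\mathcal{S}}(f)(x)=0$ for all $x\in D$. The dominant term of a nonzero polynomial is its homogeneous component of highest degree. A real polynomial $P$ in $d$ variables is an $\mathrm{a}^+$-polynomial on $\mathbb{R}_+^d$ if it is discrete harmonic on $\mathbb{R}_+^d$, vanishes on the boundary $\partial\mathbb{R}_+^d$, and is asymptotically positive, meaning that its dominant term is positive on the interior $(0,\infty)^d$. A finite Coxeter group here means a finite subgroup of the orthogonal group $O(d)$ generated by (orthogonal) reflections through linear hyperplanes; its Weyl chambers are the closures of the connected components of the complement in $\mathbb{R}^d$ of the union of all hyperplanes $F$ such that the reflection through $F$ belongs to the group. ''C is a Weyl chamber of a finite Coxeter group'' means that such a group exists having $C$ as one of its Weyl chambers. *)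

(* Defs.v *)
(* Only the canonical structures and coercions of
   mpoly are imported: its notations clash with those of MathComp-Analysis. *)
From HB Require Import structures.
From mathcomp Require Import all_boot all_order all_algebra finmap.
From mathcomp Require Import all_classical all_reals all_analysis.
From mathcomp Require Import (canonicals, coercions) mpoly.

Set Implicit Arguments.
Unset Strict Implicit.
Unset Printing Implicit Defensive.

Import Order.TTheory GRing.Theory Num.Theory.
Import numFieldNormedType.Exports.

Local Open Scope classical_set_scope.
Local Open Scope ring_scope.

(* Vectors of R^d are row vectors, on which matrices act on the right; every
   linear map used below is symmetric or ranges over a group of orthogonal
   matrices, so the side of the action is immaterial. *)

Section Euclidean.
Variables (R : realType) (d : nat).
Implicit Types (u v x : 'rV[R]_d) (M Q : 'M[R]_d).

Definition dotmul u v : R := (u *m v^T) 0 0.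

(* The library norm on row vectors is the sup norm, not this one. *)
Definition enorm u : R := Num.sqrt (dotmul u u).

Definition angle u v : R := acos (dotmul u v / (enorm u * enorm v)).

Definition posdefmx M : Prop :=
  M^T = M /\ forall x, x != 0 -> 0 < dotmul (x *m M) x.

(* The positive definite square root, unique when M is positive definite;
   0 if there is none. *)
Definition sqrtmx M : 'M[R]_d :=
  xget 0 [set Q | posdefmx Q /\ Q *m Q = M].

Definition orthant : set 'rV[R]_d := [set x | forall i, 0 <= x 0 i].

Definition open_orthant : set 'rV[R]_d := [set x | forall i, 0 < x 0 i].

Definition boundary (A : set 'rV[R]_d) : set 'rV[R]_d := closure A `\` A°.

End Euclidean.

Section Coxeter.
Variables (R : realType) (d : nat).

Definition orthogonal_group : set 'M[R]_d := [set M | M *m M^T = 1%:M].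

(* The orthogonal reflection through the hyperplane normal to u (u != 0). *)
Definition reflmx (u : 'rV[R]_d) : 'M[R]_d :=
  1%:M - (2 / dotmul u u) *: (u^T *m u).

Definition reflections : set 'M[R]_d :=
  [set M | exists2 u : 'rV[R]_d, u != 0 & M = reflmx u].

Definition matrix_group (W : set 'M[R]_d) : Prop :=
  [/\ W 1%:M, (forall g h, W g -> W h -> W (g *m h)) &
      (forall g, W g -> g \in unitmx /\ W (invmx g))].

Definition finite_coxeter_group (W : set 'M[R]_d) : Prop :=
  [/\ finite_set W, W `<=` orthogonal_group, matrix_group W &
      exists2 T : set 'M[R]_d, T `<=` reflections & W = smallest matrix_group T].

(* The union of the hyperplanes F such that the reflection through F is in W. *)
Definition mirrors (W : set 'M[R]_d) : set 'rV[R]_d :=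
  [set x | exists u : 'rV[R]_d, [/\ u != 0, W (reflmx u) & dotmul x u = 0]].

Definition weyl_chamber_of (W : set 'M[R]_d) (C : set 'rV[R]_d) : Prop :=
  exists2 x, (~` mirrors W) x & C = closure (connected_component (~` mirrors W) x).

Definition is_weyl_chamber (C : set 'rV[R]_d) : Prop :=
  exists2 W, finite_coxeter_group W & weyl_chamber_of W C.

End Coxeter.

Section Walk.
Variables (R : realType) (d : nat).
Variables (S : {fset 'rV[R]_d}) (a : 'rV[R]_d -> R).

Definition covmx : 'M[R]_d :=
  \matrix_(i, j) ((\sum_(s <- S) a s * s 0 i * s 0 j) /
    (Num.sqrt (\sum_(s <- S) a s * s 0 i ^+ 2) *
     Num.sqrt (\sum_(s <- S) a s * s 0 j ^+ 2))).

Definition invsqrt_cov : 'M[R]_d := invmx (sqrtmx covmx).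

Definition walk_cone : set 'rV[R]_d :=
  (fun x : 'rV[R]_d => x *m invsqrt_cov) @` @orthant R d.

(* When d = 2 and i != j, walk_cone is the planar sector spanned by these two
   vectors, and this is its interior angle. *)
Definition walk_cone_angle (i j : 'I_d) : R :=
  angle (delta_mx 0 i *m invsqrt_cov) (delta_mx 0 j *m invsqrt_cov).

Definition laplacian (f : 'rV[R]_d -> R) (x : 'rV[R]_d) : R :=
  (\sum_(s <- S) a s * f (x + s)) - f x.

Definition discrete_harmonic (D : set 'rV[R]_d) (f : 'rV[R]_d -> R) : Prop :=
  forall x, D x -> laplacian f x = 0.

Definition poly_fun (P : mpoly.mpoly d R) (x : 'rV[R]_d) : R :=
  mpoly.meval (fun i => x 0 i) P.

(* msize P = deg P + 1 for P != 0. *)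
Definition dominant_term (P : mpoly.mpoly d R) : mpoly.mpoly d R :=
  mpoly.pihomog mpoly.mdeg (mpoly.msize P).-1 P.

Definition aplus_polynomial (P : mpoly.mpoly d R) : Prop :=
  [/\ P != 0,
      discrete_harmonic (@orthant R d) (poly_fun P),
      (forall x, boundary (@orthant R d) x -> poly_fun P x = 0) &
      (forall x, open_orthant x -> 0 < poly_fun (dominant_term P) x)].

End Walk.

(* Main.v *)
(* Write D for the second-order operator sum_ij Sigma_ij d_i d_j, Sigma being
   the unnormalized covariance matrix. By Taylor expansion, the dominant term H
   of a discrete harmonic polynomial satisfies D H = 0. If H moreover vanishes
   on the hyperplane x_i = 0, it is odd under the reflection in this hyperplane
   that is orthogonal for the scalar product of Sigma^-1 (Schwarz reflection).
   In the coordinates where Sigma is the identity, the orthant becomes the cone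
   C, and H is multiplied by the determinant under the group W generated by the
   reflections in the walls of C. The images of the walls under W are among the
   finitely many hyperplanes on which H vanishes, so W is finite; and H > 0
   inside C, so no mirror of W meets the interior of C.

   In the plane, let C have angle theta, so that the correlation is
   - cos theta. If C is a chamber, the multiples of theta are exactly the angles
   of mirrors, whence pi is one of them. If theta = pi/n, the polynomial
   sum_j binom(n, j) sin(j theta) (x_0/s_0)^j (x_1/s_1)^(n-j) is annihilated by
   D, vanishes on the axes and is positive between them. There is no nonzero such
   homogeneous polynomial, even without positivity, in a degree less than n;
   hence G |-> L(x_0 x_1 G) is injective on polynomials of degree at most n - 3,
   thus surjective, and the polynomial can be corrected into an exactly discrete
   harmonic one. *)

Require Import Defs.
From HB Require Import structures.
From mathcomp Require Import all_boot all_order all_algebra finmap.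
From mathcomp Require Import all_classical all_reals all_analysis.
From mathcomp Require Import zify ring lra.
From mathcomp Require Import -(notations) mpoly complex.

Set Implicit Arguments.
Unset Strict Implicit.
Unset Printing Implicit Defensive.

Import Order.TTheory GRing.Theory Num.Theory.
Import numFieldNormedType.Exports.

Local Open Scope classical_set_scope.
Local Open Scope ring_scope.

(** * Polynomials and the discrete Laplacian *)

(** The integers below [size q] would be more distinct roots than a nonzero [q] admits. *)
Lemma poly_eq0_on_nneg (F : realFieldType) (q : {poly F}) :
  (forall t, 0 <= t -> q.[t] = 0) -> q = 0.
Proof.
move=> q0; apply/eqP; apply: contraT => q_neq0.
have := @max_poly_roots _ q [seq i%:R | i <- iota 0 (size q)] q_neq0.
rewrite size_map size_iota ltnn; apply.
  by apply/allP => _ /mapP[i _ ->]; apply/rootP/q0/ler0n.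
rewrite map_inj_uniq ?iota_uniq // => i j /eqP.
by rewrite eqr_nat => /eqP.
Qed.

(** Uniqueness of digits in base N: reduction modulo N reads off the lowest one, and division by N
    leaves the others to the induction. *)
Lemma sum_expn_inj (N n : nat) (e e' : 'I_n -> nat) :
  (forall i, (e i < N)%N) -> (forall i, (e' i < N)%N) ->
  (\sum_i e i * N ^ i = \sum_i e' i * N ^ i)%N -> e =1 e'.
Proof.
elim: n e e' => [|n IH] e e' he he' E; first by case.
have shiftE (g : 'I_n.+1 -> nat) :
    (\sum_i g i * N ^ i =
       (\sum_(i < n) g (lift ord0 i) * N ^ i) * N + g ord0)%N.
  rewrite big_ord_recl expn0 muln1 addnC big_distrl /=; congr addn.
  by apply: eq_bigr => i _; rewrite -mulnA -expnSr.
have N0 : (0 < N)%N by apply: leq_ltn_trans (he ord0).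
rewrite !shiftE in E.
have E0 : e ord0 = e' ord0.
  by move: (congr1 (modn^~ N) E); rewrite !modnMDl !modn_small.
move: E; rewrite E0 => /addIn/eqP; rewrite eqn_pmul2r // => /eqP E.
move=> i; case: (unliftP ord0 i) => [j|] -> //.
by apply: (IH (e \o lift ord0) (e' \o lift ord0)) => // k; rewrite ?he ?he'.
Qed.

(* Kronecker substitution: at the point (t^(N^i))_i with N > deg p, distinct
   monomials of p take distinct powers of t as values. *)
Lemma mpoly_eq0_on_nneg (F : realFieldType) (n : nat) (p : mpoly n F) :
  (forall v : 'I_n -> F, (forall i, 0 <= v i) -> meval v p = 0) -> p = 0.
Proof.
move=> p0; set N := mmeasure mdeg p.
pose kr (m : multinom n) := (\sum_i m i * N ^ i)%N.
pose q := \sum_(m <- msupp p) mcoeff m p *: 'X^(kr m) : {poly F}.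
have q0 : q = 0.
  apply: poly_eq0_on_nneg => t t0.
  rewrite -(p0 (fun i => t ^+ (N ^ i))) => [|i]; last exact: exprn_ge0.
  rewrite mevalE horner_sum; apply: eq_bigr => m _.
  rewrite hornerZ hornerXn /kr -prodrXr; congr (_ * _).
  by apply: eq_bigr => i _; rewrite -exprM mulnC.
have lt_msupp (m : multinom n) : m \in msupp p -> forall i, (m i < N)%N.
  move=> /msize_mdeg_lt mN i; apply: leq_ltn_trans mN.
  by rewrite mdegE (bigD1 i) //= leq_addr.
apply/mpolyP => m; rewrite mcoeff0; apply/eqP; apply: contraT.
rewrite -mcoeff_msupp => mp.
move: (congr1 (fun r : {poly F} => r`_(kr m)) q0).
rewrite /q coef_sum coef0 (bigD1_seq m mp (msupp_uniq p)) /=.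
rewrite coefZ coefXn eqxx mulr1 big_seq_cond big1 ?addr0 =>
  [cm0|m' /andP[m'p mm']].
  by rewrite mcoeff_msupp cm0 eqxx in mp.
rewrite coefZ coefXn; case: eqP => [E|]; last by rewrite mulr0.
case/eqP: mm'; apply/mnmP => i; apply/esym.
by apply: (@sum_expn_inj N) => //; exact: lt_msupp.
Qed.

(** * Directional derivatives, restriction to lines, and oddness across a hyperplane *)

Section DirectionalDerivatives.
Variables (F : realFieldType) (n : nat).
Implicit Types (c s y : 'I_n -> F) (M : 'M[F]_n) (p q : mpoly n F).

Definition dirder c p : mpoly n F := \sum_j c j *: mderiv j p.

(** For [M = momentmx S a] this is the operator D of the overview. *)
Definition quadder M p : mpoly n F :=
  \sum_i \sum_j M i j *: mderiv i (mderiv j p).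

Lemma dirderD c p q : dirder c (p + q) = dirder c p + dirder c q.
Proof.
by rewrite -big_split; apply: eq_bigr => j _; rewrite mderivD scalerDr.
Qed.

Lemma dirderZ c a p : dirder c (a *: p) = a *: dirder c p.
Proof.
rewrite scaler_sumr; apply: eq_bigr => j _.
by rewrite mderivZ !scalerA mulrC.
Qed.

Lemma dirder0 c : dirder c 0 = 0.
Proof. by apply: big1 => j _; rewrite mderiv0 scaler0. Qed.

Lemma dirder_sum c (I : Type) (r : seq I) (G : I -> mpoly n F) :
  dirder c (\sum_(i <- r) G i) = \sum_(i <- r) dirder c (G i).
Proof.
elim: r => [|i r IH]; last by rewrite !big_cons dirderD IH.
by rewrite !big_nil dirder0.
Qed.

Lemma dirderM c p q : dirder c (p * q) = dirder c p * q + p * dirder c q.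
Proof.
rewrite /dirder mulr_suml mulr_sumr -big_split; apply: eq_bigr => j _ /=.
by rewrite mderivM scalerDr scalerAl scalerAr.
Qed.

Lemma dirderC c (a : F) : dirder c (mpolyC n a) = 0.
Proof. by apply: big1 => j _; rewrite mderivC scaler0. Qed.

Lemma dirderX c i : dirder c (mpolyX F (mnm1 i)) = mpolyC n (c i).
Proof.
rewrite /dirder (bigD1 i) //= big1 => [|j ji].
  rewrite addr0 mderivX mnm1E eqxx scale1r.
  have -> : mnm_sub (mnm1 i) (mnm1 i) = mnm0 by
    apply/mnmP => k; rewrite mnmBE mnm0E subnn.
  by rewrite mpolyX0 -mul_mpolyC mulr1.
by rewrite mderivX mnm1E eq_sym (negbTE ji) scale0r scaler0.
Qed.

Lemma dirder_comm c j p : dirder c (mderiv j p) = mderiv j (dirder c p).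
Proof.
rewrite /dirder raddf_sum; apply: eq_bigr => k _ /=.
by rewrite mderivZ mderiv_comm.
Qed.

Lemma dirder_quadder c M p : dirder c (quadder M p) = quadder M (dirder c p).
Proof.
rewrite /quadder dirder_sum; apply: eq_bigr => i _.
rewrite dirder_sum; apply: eq_bigr => j _.
by rewrite dirderZ !dirder_comm.
Qed.

Lemma dirder_dirder c p :
  dirder c (dirder c p) = quadder (\matrix_(i, j) (c i * c j)) p.
Proof.
rewrite {1}/dirder /quadder; apply: eq_bigr => i _.
rewrite -dirder_comm /dirder scaler_sumr; apply: eq_bigr => j _.
by rewrite mxE scalerA mderiv_comm.
Qed.

Lemma quadderDl M M' p : quadder (M + M') p = quadder M p + quadder M' p.
Proof.
rewrite -big_split; apply: eq_bigr => i _; rewrite -big_split.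
by apply: eq_bigr => j _; rewrite mxE scalerDl.
Qed.

Lemma quadderZl a M p : quadder (a *: M) p = a *: quadder M p.
Proof.
rewrite scaler_sumr; apply: eq_bigr => i _; rewrite scaler_sumr.
by apply: eq_bigr => j _; rewrite mxE scalerA.
Qed.

Lemma quadder_suml (I : Type) (r : seq I) (M : I -> 'M[F]_n) p :
  quadder (\sum_(i <- r) M i) p = \sum_(i <- r) quadder (M i) p.
Proof.
elim: r => [|i r IH]; last by rewrite !big_cons quadderDl IH.
rewrite !big_nil; apply: big1 => j _; apply: big1 => k _.
by rewrite mxE scale0r.
Qed.

Lemma mcoeff_quadder M p m :
  mcoeff m (quadder M p) =
  \sum_i \sum_j M i j *
    (mcoeff (mnm_add (mnm_add m (mnm1 i)) (mnm1 j)) p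
       *+ (mnm_add m (mnm1 i) j).+1 *+ (m i).+1).
Proof.
rewrite raddf_sum; apply: eq_bigr => i _; rewrite raddf_sum /=.
by apply: eq_bigr => j _; rewrite mcoeffZ !mcoeff_mderiv.
Qed.

(** The restriction of p to the line through y directed by c. It turns derivatives along c into
    ordinary ones, so that roots and coefficients of univariate polynomials become available. *)
Definition line y c p : {poly F} :=
  mmap polyC (fun i => (y i)%:P + (c i)%:P * 'X) p.

Lemma lineD y c p q : line y c (p + q) = line y c p + line y c q.
Proof. exact: mmapD. Qed.

Lemma lineM y c p q : line y c (p * q) = line y c p * line y c q.
Proof. exact: rmorphM. Qed.

Lemma lineC y c a : line y c (mpolyC n a) = a%:P.
Proof. exact: mmapC. Qed.

Lemma lineX y c i : line y c (mpolyX F (mnm1 i)) = (y i)%:P + (c i)%:P * 'X.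
Proof. by rewrite /line mmapX mmap1U. Qed.

Lemma horner_line y c p t :
  (line y c p).[t] = meval (fun i => y i + c i * t) p.
Proof.
rewrite /line /mmap horner_sum mevalE; apply: eq_bigr => m _.
rewrite hornerM hornerC horner_prod; congr (_ * _).
by apply: eq_bigr => i _; rewrite horner_exp !hornerE.
Qed.

Lemma size_line y c p : (size (line y c p) <= mmeasure mdeg p)%N.
Proof.
apply/(leq_trans (size_sum _ _ _))/bigmax_leqP_seq => m /msize_mdeg_lt mp _.
apply: leq_trans (size_polyMleq _ _) _; rewrite size_polyC.
pose h i : {poly F} := (y i)%:P + (c i)%:P * 'X.
have szm : (size (mmap1 h m) <= (mdeg m).+1)%N.
  rewrite mdegE /mmap1; elim/big_rec2: _ => [|i k r _ hr].
    by rewrite size_poly1.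
  apply: leq_trans (size_polyMleq _ _) _ => /=.
  have : (size (h i ^+ m i)%R <= (m i).+1)%N.
    apply: leq_trans (size_poly_exp_leq _ _) _; rewrite ltnS.
    apply: leq_trans (leq_mul (_ : _ <= 1)%N (leqnn _)) _;
      last by rewrite mul1n.
    rewrite /h addrC -subn1 leq_subLR addn1 size_MXaddC.
    by case: ifP => // _; rewrite ltnS size_polyC leq_b1.
  by move: hr; set a := size _; set b := size _ => *; lia.
by move: szm; rewrite -/h; case: eqP => _ /=; set a := size _ => *; lia.
Qed.

(** Induction over ring generators, suited to [deriv_line], whose two sides both obey the Leibniz
    rule. *)
Lemma mpoly_ind_ring (P : mpoly n F -> Prop) :
  (forall a, P (mpolyC n a)) -> (forall i, P (mpolyX F (mnm1 i))) ->
  (forall p q, P p -> P q -> P (p + q)) ->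
  (forall p q, P p -> P q -> P (p * q)) -> forall p, P p.
Proof.
move=> PC PX PD PM p; rewrite [p]mpolyE.
have P0 : P 0 by rewrite -mpolyC0.
elim/big_rec: _ => // m q _ Pq; apply: (PD) => //.
rewrite -mul_mpolyC; apply: (PM) => //; rewrite mpolyXE_id.
elim/big_rec: _ => [|i r _ Pr]; first by rewrite -mpolyC1.
apply: (PM) => //; elim: (m i) => [|k IH]; first by rewrite expr0 -mpolyC1.
by rewrite exprS; apply: (PM).
Qed.

Lemma deriv_line y c p : (line y c p)^`() = line y c (dirder c p).
Proof.
elim/mpoly_ind_ring: p => [a|i|p q hp hq|p q hp hq].
- by rewrite lineC derivC dirderC -mpolyC0 lineC.
- by rewrite lineX dirderX lineC derivD derivM !derivC derivX mul0r mulr1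
  !add0r.
- by rewrite lineD derivD hp hq dirderD lineD.
- by rewrite lineM derivM hp hq dirderM lineD !lineM.
Qed.

Lemma derivn_line y c p k :
  (line y c p)^`(k) = line y c (iter k (dirder c) p).
Proof. by elim: k => [//|k IH]; rewrite derivnS IH deriv_line. Qed.

(* Divisibility of p by the i-th variable, read off the coefficients. *)
Definition mvdvd i p := forall m : multinom n, m i = 0%N -> mcoeff m p = 0.

Lemma mvdvd_meval i p y : mvdvd i p -> y i = 0 -> meval y p = 0.
Proof.
move=> ip yi; rewrite mevalE big1 // => m _.
have [mi|mi] := eqVneq (m i) 0%N; first by rewrite ip // mul0r.
by rewrite (bigD1 i) //= yi expr0n (negbTE mi) mul0r mulr0.
Qed.

(** The part q of p free of the i-th variable takes at v the value of p at the projection of v to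
    the face, so q vanishes on the whole orthant and is zero. *)
Lemma mvdvd_face i p :
  (forall v : 'I_n -> F, (forall j, 0 <= v j) -> v i = 0 -> meval v p = 0) ->
  mvdvd i p.
Proof.
move=> p0; pose q : mpoly n F := \sum_(m <- msupp p | m i == 0%N) mcoeff m p *:
  mpolyX F m.
have cq m : mcoeff m q = if m i == 0%N then mcoeff m p else 0.
  rewrite raddf_sum /= -big_filter.
  have [mp|mp] := boolP (m \in [seq m : multinom n <- msupp p | m i == 0%N]).
    rewrite (bigD1_seq m) ?filter_uniq ?msupp_uniq //= big1 ?addr0.
      by move: mp; rewrite mem_filter => /andP[-> _];
        rewrite mcoeffZ mcoeffX eqxx mulr1.
    by move=> m' mm'; rewrite mcoeffZ mcoeffX (negbTE mm') mulr0.
  rewrite big_seq big1 => [|m' m'p].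
    move: mp; rewrite mem_filter; case: eqP => //= _.
    by rewrite mcoeff_msupp negbK => /eqP.
  rewrite mcoeffZ mcoeffX; case: eqP => [E|]; last by rewrite mulr0.
  by rewrite -E m'p in mp.
have q0 : q = 0.
  apply: mpoly_eq0_on_nneg => v v0; pose w j := if j == i then 0 else v j.
  transitivity (meval w p); last first.
    by apply: p0 => [j|]; rewrite /w; case: eqP.
  rewrite raddf_sum mevalE /= [RHS](bigID (fun m : multinom n =>
    m i == 0%N)) /=.
  rewrite [X in _ + X]big1 ?addr0 => [|m mi].
    apply: eq_bigr => m mi; rewrite mevalZ mevalX; congr (_ * _).
    apply: eq_bigr => j _; rewrite /w; case: eqP => // ->.
    by rewrite (eqP mi) !expr0.
  by rewrite (bigD1 i) //= /w eqxx expr0n (negbTE mi) mul0r mulr0.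
by move=> m mi; have := cq m; rewrite q0 mcoeff0 mi eqxx.
Qed.

(** Only derivatives in the other variables occur, and these leave the exponent of the i-th one
    unchanged. *)
Lemma mvdvd_quadder i M p : mvdvd i p ->
  (forall j, M i j = 0) -> (forall j, M j i = 0) -> mvdvd i (quadder M p).
Proof.
move=> ip Mi0 M0i m mi; rewrite mcoeff_quadder big1 // => j _.
rewrite big1 // => k _.
have [->|ji] := eqVneq j i; first by rewrite Mi0 mul0r.
have [->|ki] := eqVneq k i; first by rewrite M0i mul0r.
by rewrite ip ?mul0rn ?mulr0 // !mnmDE !mnm1E mi (negbTE ji) (negbTE ki).
Qed.

(* The derivation along [c], the direction conjugate to the hyperplane
   [x_i = 0], splits off the operator: [quadder M = M i i * dirder c ^ 2 + Q],
   where Q does not differentiate with respect to [x_i] and hence preserves the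
   multiples of [x_i]. So all derivatives of p of even order along [c] are
   multiples of [x_i]. *)
Lemma quadder_harmonic_odd i M p y t : M^T = M -> M i i != 0 ->
  mvdvd i p -> quadder M p = 0 -> y i = 0 ->
  meval (fun j => y j - M i j / M i i * t) p =
  - meval (fun j => y j + M i j / M i i * t) p.
Proof.
move=> Msym Mii ip Mp yi.
have MC j k : M j k = M k j by rewrite -{1}Msym mxE.
pose c j := M i j / M i i.
(* This is Q. Since c i = 1, subtracting the square of c clears the i-th row and column of M. *)
pose M' := M - M i i *: \matrix_(j, k) (c j * c k).
have step q : mvdvd i q -> quadder M q = 0 ->
    mvdvd i (dirder c (dirder c q)) /\ quadder M (dirder c (dirder c q)) = 0.
  move=> iq Mq; split; last first.
    by rewrite -!dirder_quadder Mq !dirder0.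
  have -> : dirder c (dirder c q) = quadder (- (M i i)^-1 *: M') q.
    have EM : M = M' + M i i *: \matrix_(j, k) (c j * c k) by rewrite subrK.
    move: Mq; rewrite {1}EM quadderDl quadderZl -dirder_dirder => /eqP.
    rewrite addr_eq0 => /eqP E.
    by rewrite quadderZl E scalerN scaleNr opprK scalerA mulVf // scale1r.
  apply: mvdvd_quadder => // j; rewrite !mxE /c.
    by rewrite divff // mul1r mulrCA divff // mulr1 subrr mulr0.
  by rewrite divff // mulr1 mulrCA divff // mulr1 MC subrr mulr0.
have even k : mvdvd i (iter k.*2 (dirder c) p).
  suff: mvdvd i (iter k.*2 (dirder c) p) /\
      quadder M (iter k.*2 (dirder c) p) = 0 by case.
  by elim: k => [//|k [IH1 IH2]]; rewrite doubleS !iterS; apply: step.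
(* Up to the factor (2k)!, this Taylor coefficient is the derivative of order 2k at y, which
   vanishes because y lies on the hyperplane. *)
have coef_even k : (line y c p)`_(k.*2) = 0.
  have := congr1 (fun q : {poly F} => q`_0) (derivn_line y c p k.*2).
  rewrite coef_derivn addn0 ffactnn -[RHS]horner_coef0 horner_line.
  rewrite (mvdvd_meval (even k)) => [/eqP|]; last by rewrite mulr0 addr0.
  by rewrite mulrn_eq0 -leqn0 leqNgt fact_gt0 => /eqP.
transitivity ((line y c p).[- t]).
  by rewrite horner_line; apply: meval_eq => j; rewrite mulrN.
rewrite -horner_line !horner_coef -sumrN; apply: eq_bigr => k _.
have [ok|ek] := boolP (odd k).
  by rewrite exprNn -signr_odd ok expr1 mulN1r mulrN.
by rewrite -(odd_double_half k) (negbTE ek) add0n coef_even !mul0r oppr0.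
Qed.

End DirectionalDerivatives.

(** * Taylor expansion of the discrete Laplacian and its effect on degrees *)

Section DiscreteLaplacian.
Variables (F : realFieldType) (n : nat).
Implicit Types (s : 'rV[F]_n) (p q : mpoly n F) (m : multinom n).

(** [mmeasure mdeg p] is one more than the degree, and 0 for the zero polynomial; truncated
    subtractions from it thus also cover polynomials that are annihilated. *)
Lemma msize_leqP p k :
  reflect (forall m, (k <= mdeg m)%N -> mcoeff m p = 0)
    (mmeasure mdeg p <= k)%N.
Proof.
apply: (iffP idP) => [pk m km|pk].
  by apply/eqP; rewrite mcoeff_eq0; apply/msize_mdeg_ge/(leq_trans pk).
apply/bigmax_leqP_seq => m mp _; rewrite ltnNge; apply/negP => /pk/eqP.
by rewrite mcoeff_eq0 mp.
Qed.

Lemma msizeM_leq p q :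
  (mmeasure mdeg (p * q) <= (mmeasure mdeg p + mmeasure mdeg q).-1)%N.
Proof.
have [->|p0] := eqVneq p 0; first by rewrite mul0r mmeasure0.
have [->|q0] := eqVneq q 0; first by rewrite mulr0 mmeasure0.
by rewrite msizeM.
Qed.

Lemma msizeZ_leq (c : F) p : (mmeasure mdeg (c *: p) <= mmeasure mdeg p)%N.
Proof.
apply/msize_leqP => m pm.
by rewrite mcoeffZ (elimT (msize_leqP p _) _ m pm) ?mulr0.
Qed.

Lemma msize_dirder (c : 'I_n -> F) p :
  (mmeasure mdeg (dirder c p) <= (mmeasure mdeg p).-1)%N.
Proof.
apply/msize_leqP => m pm; rewrite raddf_sum big1 //= => j _.
rewrite mcoeffZ mcoeff_mderiv.
rewrite (elimT (msize_leqP p _) (leqnn _)) ?mul0rn ?mulr0 //.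
by rewrite mdegD mdeg1; lia.
Qed.

Lemma msize_quadder (M : 'M[F]_n) p :
  (mmeasure mdeg (quadder M p) <= mmeasure mdeg p - 2)%N.
Proof.
apply/msize_leqP => m pm; rewrite mcoeff_quadder big1 // => i _.
rewrite big1 // => j _.
rewrite (elimT (msize_leqP p _) (leqnn _)) ?mul0rn ?mulr0 //.
by rewrite !mdegD !mdeg1; lia.
Qed.

Lemma mcoeff_pihomog k p m :
  mcoeff m (pihomog mdeg k p) = if mdeg m == k then mcoeff m p else 0.
Proof.
rewrite /pihomog raddf_sum /= -big_filter.
case: ifP => mk; last first.
  rewrite big_seq big1 // => m'; rewrite mem_filter => /andP[m'k _].
  rewrite mcoeffZ mcoeffX; case: eqP => [E|]; last by rewrite mulr0.
  by rewrite E mk in m'k.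
have [mp|] := boolP (m \in msupp p); last first.
  move=> mp; rewrite big_seq big1 => [|m'].
    by apply/esym/eqP; rewrite mcoeff_eq0.
  rewrite mem_filter mcoeffZ mcoeffX => /andP[_ m'p].
  by case: eqP mp => [<-|]; rewrite ?m'p ?mulr0.
rewrite (bigD1_seq m) ?filter_uniq ?msupp_uniq ?mem_filter ?mk //= big1.
  by rewrite mcoeffZ mcoeffX eqxx mulr1 addr0.
by move=> m' mm'; rewrite mcoeffZ mcoeffX (negbTE mm') mulr0.
Qed.

Definition mshift s p : mpoly n F :=
  mmap (@mpolyC n F) (fun i => mpolyX F (mnm1 i) + mpolyC n (s 0 i)) p.

Lemma meval_mshift s p (x : 'rV[F]_n) :
  meval (fun i => x 0 i) (mshift s p) = meval (fun i => (x + s) 0 i) p.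
Proof.
rewrite /mshift /mmap raddf_sum mevalE; apply: eq_bigr => m _ /=.
rewrite mul_mpolyC mevalZ; congr (_ * _); rewrite /mmap1 rmorph_prod.
apply: eq_bigr => i _; rewrite rmorphXn /=; congr (_ ^+ _).
by rewrite mevalD mevalXU mevalC mxE.
Qed.

Definition taylor_rem s p : mpoly n F :=
  mshift s p - p - dirder (s 0) p - 2^-1 *: dirder (s 0) (dirder (s 0) p).

Lemma taylor_remD s p q : taylor_rem s (p + q) = taylor_rem s p + taylor_rem s
  q.
Proof.
have subD (x y z t : mpoly n F) : x + y - (z + t) = x - z + (y - t).
  by rewrite opprD addrACA.
rewrite /taylor_rem !dirderD scalerDr /mshift mmapD (subD (mmap _ _ p)).
by rewrite (subD (mmap _ _ p - p)) (subD (mmap _ _ p - p - _)).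
Qed.

Lemma taylor_remZ s (c : F) p : taylor_rem s (c *: p) = c *: taylor_rem s p.
Proof.
rewrite /taylor_rem !dirderZ /mshift mmapZ /= mul_mpolyC !scalerBr.
by rewrite !scalerA mulrC.
Qed.

(** The shift is multiplicative and [dirder] obeys the Leibniz rule; only half of the second
    derivative, times [s 0 i], is left over. This is the induction step for the degree of the
    remainder. *)
Lemma taylor_remXM s i p :
  taylor_rem s (mpolyX F (mnm1 i) * p) =
  (mpolyX F (mnm1 i) + mpolyC n (s 0 i)) * taylor_rem s p +
  (2^-1 * s 0 i) *: dirder (s 0) (dirder (s 0) p).
Proof.
rewrite /taylor_rem.
have -> : mshift s (mpolyX F (mnm1 i) * p) =
    (mpolyX F (mnm1 i) + mpolyC n (s 0 i)) * mshift s p.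
  by rewrite /mshift rmorphM /= mmapX mmap1U.
rewrite !(dirderM, dirderD) !dirderX dirderC mul0r add0r.
rewrite -!mul_mpolyC mpolyCM.
set h := mpolyC n 2^-1; set c := mpolyC n (s 0 i).
have h2 : 1 - (h + h) = 0 by rewrite -mpolyCD -mpolyC1 -mpolyCB -mpolyC0;
  congr mpolyC; lra.
apply/eqP; rewrite -subr_eq0; apply/eqP.
(* The constant h is opaque to [ring], so the difference is factored through 1 - 2h, which is 0. *)
transitivity ((1 - (h + h)) * (c * dirder (s 0) p)); first by ring.
by rewrite h2 mul0r.
Qed.

(** By linearity it is enough to treat monomials, for which variables are split off one at a time
    with [taylor_remXM]. *)
Lemma msize_taylor_rem s p :
  (mmeasure mdeg (taylor_rem s p) <= mmeasure mdeg p - 3)%N.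
Proof.
have rem0 : taylor_rem s 0 = 0 by rewrite -(scale0r (0 :
  mpoly n F)) taylor_remZ !scale0r.
suff remX k m : mdeg m = k ->
  (mmeasure mdeg (taylor_rem s (mpolyX F m)) <= k - 2)%N.
  have -> : taylor_rem s p =
      \sum_(m <- msupp p) mcoeff m p *: taylor_rem s (mpolyX F m).
    rewrite {1}[p]mpolyE; elim: (msupp p) => [|m r IH]; rewrite ?big_nil //.
    by rewrite !big_cons taylor_remD taylor_remZ IH.
  apply: leq_trans (mmeasure_sum _ _ _ _) _.
  apply/bigmax_leqP_seq => m /msize_mdeg_lt mp _.
  apply: leq_trans (msizeZ_leq _ _) _; apply: leq_trans (remX _ _ erefl) _; lia.
elim: k m => [|k IH] m mk.
  move/eqP: mk; rewrite mdeg_eq0 => /eqP ->; rewrite mpolyX0 /taylor_rem.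
  rewrite /mshift rmorph1 subrr -mpolyC1 dirderC dirder0 scaler0 !subr0.
  by rewrite mmeasure0.
have [i mi] : exists i, m i != 0%N.
  apply/existsP; apply: contraPT mk => /existsPn m0.
  by rewrite mdegE big1 // => i _; apply/eqP; move: (m0 i); rewrite negbK.
have Em : m = mnm_add (mnm1 i) (mnm_sub m (mnm1 i)).
  apply/mnmP => j; rewrite mnmDE mnmBE mnm1E; case: eqP => [<-|_] /=; last lia.
  by move: mi; lia.
move: mk; rewrite {}Em; set m' := mnm_sub m _ => mk.
have {}mk : mdeg m' = k by move: mk; rewrite mdegD mdeg1; lia.
rewrite mpolyXD taylor_remXM.
apply: leq_trans (mmeasureD_le _ _ _) _; rewrite geq_max; apply/andP; split.
  (* For a zero remainder the size bound of a product, (2 + 0) - 1, can be too weak. *)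
  have [->|r0] := eqVneq (taylor_rem s (mpolyX F m')) 0.
    by rewrite mulr0 mmeasure0.
  apply: leq_trans (msizeM_leq _ _) _.
  have : (mmeasure mdeg (mpolyX F (mnm1 i) + mpolyC n (s 0%R i))%R <= 2)%N.
    apply: leq_trans (mmeasureD_le _ _ _) _.
    by rewrite geq_max msizeX mdeg1 mmeasureC /=; case: (_ == 0).
  move: (IH _ mk) r0; rewrite -(mmeasure_poly_eq0 mdeg); lia.
apply: leq_trans (msizeZ_leq _ _) _; apply: leq_trans (msize_dirder _ _) _.
have := msize_dirder (s 0) (mpolyX F m'); rewrite msizeX mk; lia.
Qed.

Variables (S : seq 'rV[F]_n) (a : 'rV[F]_n -> F).

Definition mlap p : mpoly n F := \sum_(s <- S) a s *: mshift s p - p.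

Definition momentmx : 'M[F]_n :=
  \matrix_(i, j) \sum_(s <- S) a s * s 0 i * s 0 j.

Lemma meval_mlap p (x : 'rV[F]_n) :
  meval (fun i => x 0 i) (mlap p) =
  \sum_(s <- S) a s * meval (fun i => (x + s) 0 i) p - meval (fun i => x 0 i) p.
Proof.
rewrite /mlap mevalB raddf_sum; congr (_ - _); apply: eq_bigr => s _ /=.
by rewrite mevalZ meval_mshift.
Qed.

Lemma mlapD p q : mlap (p + q) = mlap p + mlap q.
Proof.
rewrite /mlap opprD addrACA -big_split; congr (_ + _); apply: eq_bigr => s _.
by rewrite /= -scalerDr /mshift mmapD.
Qed.

Lemma mlapZ (c : F) p : mlap (c *: p) = c *: mlap p.
Proof.
rewrite /mlap scalerBr scaler_sumr; congr (_ - _); apply: eq_bigr => s _.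
by rewrite /mshift mmapZ mul_mpolyC !scalerA mulrC.
Qed.

Lemma momentmx_tr : momentmx^T = momentmx.
Proof.
by apply/matrixP => i j; rewrite !mxE; apply: eq_bigr => s _; rewrite mulrAC.
Qed.

(** In the averaged Taylor expansion, total mass 1 cancels the term of order 0, zero drift the term
    of order 1, and the term of order 2 is half of D; only the remainders survive. *)
Lemma mlap_quadder_size p : \sum_(s <- S) a s = 1 -> \sum_(s <- S) a s *:
  s = 0 ->
  (mmeasure mdeg (mlap p - 2^-1 *: quadder momentmx p)
     <= mmeasure mdeg p - 3)%N.
Proof.
move=> a1 a0.
have -> : mlap p - 2^-1 *: quadder momentmx p =
    \sum_(s <- S) a s *: taylor_rem s p.
  have -> : momentmx = \sum_(s <- S) a s *: \matrix_(i, j) (s 0 i * s 0 j).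
    apply/matrixP => i j; rewrite !mxE summxE; apply: eq_bigr => s _.
    by rewrite !mxE mulrA.
  rewrite quadder_suml scaler_sumr.
  under [X in _ - X = _]eq_bigr => s _ do
    rewrite quadderZl -dirder_dirder scalerA mulrC -scalerA.
  under [RHS]eq_bigr => s _ do rewrite /taylor_rem !scalerBr.
  rewrite !sumrB /mlap -scaler_suml a1 scale1r; congr (_ - _).
  have -> : \sum_(s <- S) a s *: dirder (s 0) p = 0; last by rewrite subr0.
  under eq_bigr => s _ do rewrite /dirder scaler_sumr.
  rewrite exchange_big big1 //= => j _.
  under eq_bigr => s _ do rewrite scalerA.
  rewrite -scaler_suml.
  have := congr1 (fun u : 'rV[F]_n => u 0 j) a0; rewrite summxE mxE => a0j.
  rewrite (eq_bigr (fun s : 'rV[F]_n => (a s *: s) 0 j)) => [|s _].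
    by rewrite a0j scale0r.
  by rewrite mxE.
apply: leq_trans (mmeasure_sum _ _ _ _) _; apply/bigmax_leqP_seq => s _ _.
by apply: leq_trans (msizeZ_leq _ _) _; exact: msize_taylor_rem.
Qed.

Lemma msize_mlap p : \sum_(s <- S) a s = 1 -> \sum_(s <- S) a s *: s = 0 ->
  (mmeasure mdeg (mlap p) <= mmeasure mdeg p - 2)%N.
Proof.
move=> a1 a0; rewrite -(subrK (2^-1 *: quadder momentmx p) (mlap p)).
apply: leq_trans (mmeasureD_le _ _ _) _; rewrite geq_max; apply/andP; split.
  by apply: leq_trans (mlap_quadder_size p a1 a0) _; lia.
by apply: leq_trans (msizeZ_leq _ _) _; exact: msize_quadder.
Qed.

Lemma mlap_quadder_dominant p : \sum_(s <- S) a s = 1 ->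
  \sum_(s <- S) a s *: s = 0 -> mlap p = 0 ->
  quadder momentmx (pihomog mdeg (mmeasure mdeg p).-1 p) = 0.
Proof.
move=> a1 a0 p0; have := mlap_quadder_size p a1 a0; rewrite p0 sub0r mmeasureN.
move=> sz; apply/mpolyP => m; rewrite mcoeff0 mcoeff_quadder.
have degE i j : mdeg (mnm_add (mnm_add m (mnm1 i)) (mnm1 j)) = (mdeg m).+2.
  by rewrite !mdegD !mdeg1 !addn1.
have [E|NE] := eqVneq (mdeg m).+2 (mmeasure mdeg p).-1; last first.
  rewrite big1 // => i _; rewrite big1 // => j _.
  by rewrite mcoeff_pihomog degE (negbTE NE) !mul0rn mulr0.
(* In degree deg p - 2 the coefficients of D p vanish, and there they are those of D applied to the
   dominant term. *)
have := elimT (msize_leqP _ _) sz m; rewrite mcoeffZ mcoeff_quadder => qm.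
under eq_bigr => i _ do under eq_bigr => j _ do
  rewrite mcoeff_pihomog degE E eqxx.
have /qm/eqP : (mmeasure mdeg p - 3 <= mdeg m)%N by lia.
by rewrite mulf_eq0 invr_eq0 pnatr_eq0 /= => /eqP.
Qed.

End DiscreteLaplacian.

(** * Reflection groups with a prescribed chamber *)

(** Both sides are determinants of Schur complements of one block matrix, factored in two ways
    through L. *)
Lemma det_1subM (F : comRingType) (n : nat) (u v : 'rV[F]_n) :
  \det (1%:M - u^T *m v) = 1 - (v *m u^T) 0 0.
Proof.
pose L : 'M[F]_(n + 1) := block_mx 1%:M 0 v 1%:M.
have detL : \det L = 1 by rewrite det_lblock !det1 mulr1.
have E : block_mx (1%:M - u^T *m v) u^T 0 1%:M *m L =
    L *m block_mx 1%:M u^T 0 (1%:M - v *m u^T).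
  rewrite !mulmx_block !mul1mx !mulmx1 !mul0mx !mulmx0 !add0r !addr0.
  by rewrite subrK addrC subrK.
move: (congr1 determinant E); rewrite !det_mulmx detL mul1r mulr1 !det_ublock.
by rewrite !det1 mulr1 mul1r det_mx11 !mxE eqxx.
Qed.

Section Reflections.
Variables (R : realType) (d : nat).
Implicit Types (u v x y : 'rV[R]_d) (g : 'M[R]_d).

Lemma dotmulE u v : dotmul u v = \sum_i u 0 i * v 0 i.
Proof. by rewrite /dotmul mxE; apply: eq_bigr => i _; rewrite !mxE. Qed.

Lemma dotmulC u v : dotmul u v = dotmul v u.
Proof. by rewrite !dotmulE; apply: eq_bigr => i _; rewrite mulrC. Qed.

Lemma dotmulDl u v x : dotmul (u + v) x = dotmul u x + dotmul v x.
Proof. by rewrite /dotmul mulmxDl mxE. Qed.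

Lemma dotmulBl u v x : dotmul (u - v) x = dotmul u x - dotmul v x.
Proof. by rewrite /dotmul mulmxBl !mxE. Qed.

Lemma dotmulZl (c : R) u x : dotmul (c *: u) x = c * dotmul u x.
Proof. by rewrite /dotmul -scalemxAl mxE. Qed.

Lemma dotmulDr u v x : dotmul x (u + v) = dotmul x u + dotmul x v.
Proof. by rewrite dotmulC dotmulDl !(dotmulC x). Qed.

Lemma dotmulBr u v x : dotmul x (u - v) = dotmul x u - dotmul x v.
Proof. by rewrite dotmulC dotmulBl !(dotmulC x). Qed.

Lemma dotmulZr (c : R) u x : dotmul x (c *: u) = c * dotmul x u.
Proof. by rewrite dotmulC dotmulZl dotmulC. Qed.

Lemma dotmul0l x : dotmul 0 x = 0.
Proof. by rewrite /dotmul mul0mx mxE. Qed.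

Lemma dotmul0r x : dotmul x 0 = 0.
Proof. by rewrite dotmulC dotmul0l. Qed.

Lemma dotmul_ge0 u : 0 <= dotmul u u.
Proof. by rewrite dotmulE; apply: sumr_ge0 => i _; rewrite -expr2 sqr_ge0. Qed.

Lemma dotmul_eq0 u : (dotmul u u == 0) = (u == 0).
Proof.
apply/eqP/eqP => [|->]; last exact: dotmul0l.
rewrite dotmulE => /eqP; rewrite psumr_eq0 => [/allP u0|i _]; last first.
  by rewrite -expr2 sqr_ge0.
apply/rowP => i; rewrite mxE; apply/eqP.
by have := u0 i (mem_index_enum _); rewrite mulf_eq0 orbb.
Qed.

Lemma dotmul_gt0 u : (0 < dotmul u u) = (u != 0).
Proof. by rewrite lt_neqAle dotmul_ge0 andbT eq_sym dotmul_eq0. Qed.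

Lemma dotmul_mulmxl u v g : dotmul (u *m g) v = dotmul u (v *m g^T).
Proof. by rewrite /dotmul trmx_mul trmxK mulmxA. Qed.

Lemma dotmul_row x (A : 'M[R]_d) i : dotmul x (row i A^T) = (x *m A) 0 i.
Proof.
by rewrite dotmulE mxE; apply: eq_bigr => j _; rewrite !mxE.
Qed.

Lemma mulmx_reflmx x u :
  x *m reflmx u = x - (2 * dotmul x u / dotmul u u) *: u.
Proof.
rewrite /reflmx mulmxBr mulmx1 -scalemxAr mulmxA.
by rewrite [x *m u^T]mx11_scalar mul_scalar_mx scalerA -/(dotmul x u) mulrAC.
Qed.

Lemma reflmxZ (c : R) u : c != 0 -> reflmx (c *: u) = reflmx u.
Proof.
move=> c0; have uT : (c *: u)^T = c *: u^T by apply/matrixP => i j;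
  rewrite !mxE.
rewrite /reflmx dotmulZl dotmulZr uT -scalemxAl -scalemxAr.
rewrite !scalerA; congr (_ - _ *: _).
have [->|u0] := eqVneq (dotmul u u) 0; first by rewrite !(mulr0, invr0, mul0r).
by field; apply/andP.
Qed.

Lemma reflmx_sym u : (reflmx u)^T = reflmx u.
Proof. by rewrite /reflmx linearB /= trmx1 linearZ /= trmx_mul trmxK. Qed.

Lemma reflmxK u : u != 0 -> reflmx u *m reflmx u = 1%:M.
Proof.
rewrite -dotmul_eq0 => u0; apply/row_matrixP => i; rewrite !rowE mulmx1 mulmxA.
rewrite !mulmx_reflmx dotmulBl dotmulZl -addrA -opprD -scalerDl.
by rewrite [X in X *: u](_ : _ = 0) ?scale0r ?subr0 //; field.
Qed.

Lemma reflmx_orthogonal u : u != 0 -> @orthogonal_group R d (reflmx u).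
Proof. by move=> u0; rewrite /orthogonal_group /= reflmx_sym reflmxK. Qed.

Lemma det_reflmx u : u != 0 -> \det (reflmx u) = -1.
Proof.
rewrite -dotmul_eq0 => u0.
rewrite /reflmx scalemxAr det_1subM -scalemxAl mxE -/(dotmul u u) mulfVK //.
by rewrite opprD addNKr.
Qed.

Lemma reflmx_fix x u : dotmul x u = 0 -> x *m reflmx u = x.
Proof. by move=> xu; rewrite mulmx_reflmx xu mulr0 mul0r scale0r subr0. Qed.

Lemma reflmx_fixP x u : u != 0 -> x *m reflmx u = x -> dotmul x u = 0.
Proof.
move=> u0; rewrite mulmx_reflmx => /(canRL (addKr _)); rewrite addrC subrr.
move=> /eqP; rewrite oppr_eq0 scaler_eq0 (negbTE u0) orbF !mulf_eq0 invr_eq0.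
by rewrite pnatr_eq0 dotmul_eq0 (negbTE u0) orbF /= => /eqP.
Qed.

Lemma reflmx_conj u g : @orthogonal_group R d g ->
  reflmx (u *m g) = g^T *m reflmx u *m g.
Proof.
move=> gg; have gtg : g^T *m g = 1%:M by rewrite mulmx1C.
rewrite /reflmx dotmul_mulmxl -mulmxA gg mulmx1 mulmxBr mulmxBl mulmx1 gtg.
by rewrite -scalemxAr -scalemxAl trmx_mul !mulmxA.
Qed.

Lemma orthogonal_matrix_group : matrix_group (@orthogonal_group R d).
Proof.
rewrite /orthogonal_group; split=> [|g h /= gg hh|g /= gg].
- by rewrite /= trmx1 mulmx1.
- by rewrite trmx_mul mulmxA -(mulmxA g) hh mulmx1.
- have [ug _] := mulmx1_unit gg; split=> //.
  have -> : invmx g = g^T by rewrite -[LHS]mulmx1 -gg mulKmx.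
  by rewrite trmxK mulmx1C.
Qed.

(** The orthogonal group is among the groups intersected and supplies the invertibility of the
    elements. *)
Lemma smallest_matrix_group (T : set 'M[R]_d) : T `<=` @orthogonal_group R d ->
  matrix_group (smallest (@matrix_group R d) T).
Proof.
move=> TO; split=> [A [[A1 _ _] _] //|g h Wg Wh A mA|g Wg].
  by have [[_ AM _] _] := mA; apply: AM; [exact: Wg|exact: Wh].
split.
  have Og := Wg _ (conj orthogonal_matrix_group TO).
  by have [ug _] := mulmx1_unit Og.
by move=> A mA; have [[_ _ AV] _] := mA; have /AV[] := Wg A mA.
Qed.

End Reflections.

(** * Topology of polyhedral cones *)

Section ConeTopology.
Variables (R : realType) (d : nat).
Implicit Types (x y u : 'rV[R]_d) (A : 'M[R]_d) (K : set 'rV[R]_d).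

Lemma dotmul_continuous u : continuous (fun x => dotmul x u).
Proof.
have cont_sum (r : seq 'I_d) :
    continuous (fun x : 'rV[R]_d => \sum_(j <- r) x 0 j * u 0 j).
  elim: r => [|j r IH].
    by under eq_fun do rewrite big_nil; exact: cst_continuous.
  under eq_fun do rewrite big_cons; move=> x.
  have cx : (fun z : 'rV[R]_d => z 0 j * u 0 j) @ x --> x 0 j * u 0 j.
    exact: (cvgM (@coord_continuous R 1 d 0 j x) (cvg_cst _)).
  exact: cvgD cx (IH x).
by under eq_fun do rewrite dotmulE; exact: cont_sum.
Qed.

Lemma mulmx_coord_continuous A i :
  continuous (fun x : 'rV[R]_d => (x *m A) 0 i).
Proof.
by under eq_fun do rewrite -dotmul_row; exact: dotmul_continuous.
Qed.

Lemma segment_continuous x y : continuous (fun t : R => x + t *: y).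
Proof.
move=> t; have cy : (fun t : R => t *: y) @ t --> t *: y.
  exact: (cvgZ cvg_id (cvg_cst y)).
exact: (cvgD (cvg_cst x) cy).
Qed.

Lemma star_connected K x : K x ->
  (forall y t, K y -> 0 <= t <= 1 -> K (x + t *: (y - x))) -> connected K.
Proof.
move=> Kx Kstar.
pose seg y := (fun t : R => x + t *: (y - x)) @` `[0, 1].
have -> : K = \bigcup_(y in K) seg y.
  apply/seteqP; split=> [y Ky|_ [y Ky [t t01 <-]]].
    exists y => //; exists 1; rewrite /= ?in_itv /= ?ler01 ?lexx //.
    by rewrite scale1r addrC subrK.
  by move: t01; rewrite /= in_itv /=; exact: Kstar.
apply: bigcup_connected.
  exists x => y Ky; exists 0; rewrite /= ?in_itv /= ?lexx ?ler01 //.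
  by rewrite scale0r addr0.
move=> y Ky; apply: connected_continuous_connected;
  first exact: segment_connected.
exact/continuous_subspaceT/segment_continuous.
Qed.

Lemma connected_sign K x (h : 'rV[R]_d -> R) : connected K -> continuous h ->
  (forall y, K y -> h y != 0) -> K x -> 0 < h x -> forall y, K y -> 0 < h y.
Proof.
move=> cK ch h0 Kx hx y Ky; rewrite ltNge; apply/negP => hy.
have /connected_intervalP iv : connected (h @` K).
  by apply: connected_continuous_connected => //; exact: continuous_subspaceT.
have [|||z Kz hz] := iv (h y) (h x) _ _ 0; [by exists y|by exists x| |].
  by rewrite hy ltW.
by move: (h0 z Kz); rewrite hz eqxx.
Qed.

Lemma closed_cone A : closed [set y : 'rV[R]_d | forall i, 0 <= (y *m A) 0 i].
Proof.
have -> : [set y : 'rV[R]_d | forall i, 0 <= (y *m A) 0 i] =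
    \bigcap_(i in [set: 'I_d]) [set y | 0 <= (y *m A) 0 i].
  by apply/seteqP; split=> y /= yA i; [move=> _|]; apply: yA.
apply: closed_bigI => i _.
apply: (@closed_comp _ _ (fun y : 'rV[R]_d => (y *m A) 0 i) [set t | 0 <= t]).
  by move=> y _; exact: mulmx_coord_continuous.
exact: closed_ge.
Qed.

(** A point y of the closed cone is the limit of the interior points y + t x as t decreases to 0. *)
Lemma closure_open_cone A x : (forall i, 0 < (x *m A) 0 i) ->
  closure [set y : 'rV[R]_d | forall i, 0 < (y *m A) 0 i] =
  [set y | forall i, 0 <= (y *m A) 0 i].
Proof.
move=> xA; apply/seteqP; split=> [y|y yA B yB].
  move=> yA; apply: (@closed_cone A); apply: closureS yA => z zA i.
  exact/ltW/zA.
have : \forall t \near 0^'+, B (y + t *: x).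
  have : (fun t : R => y + t *: x) @ (0 : R)^'+ --> y.
    apply: cvg_at_right_filter; rewrite -[X in _ --> X]addr0 -(scale0r x).
    exact: segment_continuous.
  by move=> /(_ B yB).
move=> Bt; near (0 : R)^'+ => t.
exists (y + t *: x); split; last by near: t.
move=> i; rewrite mulmxDl -scalemxAl !mxE.
by rewrite ltr_wpDl ?mulr_gt0 //; [move: (yA i)|move: (xA i)]; rewrite !mxE.
Unshelve. all: by end_near.
Qed.

End ConeTopology.

(** * Finiteness of the group generated by the wall reflections *)

Section FiniteReflectionGroup.
Variables (R : realType) (d : nat).
Implicit Types (x y u w : 'rV[R]_d) (g : 'M[R]_d).

(* The vectors (1, t, ..., t^(d-1)) of the moment curve: [dotmul] of such a
   vector with w is the value at t of the nonzero polynomial [rVpoly w]. *)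
Lemma exists_nonorthogonal (s : seq 'rV[R]_d) : all (fun w => w != 0) s ->
  exists q : 'rV[R]_d, all (fun w => dotmul q w != 0) s.
Proof.
move=> s0; pose r : {poly R} := \prod_(w <- s) rVpoly w.
have r0 : r != 0.
  rewrite prodf_seq_neq0; apply/allP => w /(allP s0) w0 /=.
  by apply: contraNneq w0 => E; rewrite -(rVpolyK w) E linear0.
have [t rt] : exists t, r.[t] != 0.
  apply: contrapT => /forallNP rt; case/eqP: r0.
  by apply: poly_eq0_on_nneg => t _; apply/eqP; have /negP := rt t;
    rewrite negbK.
exists (\row_i t ^+ i); apply/allP => w ws.
have -> : dotmul (\row_i t ^+ i) w = (rVpoly w).[t].
  rewrite dotmulE /rVpoly horner_poly; apply: eq_bigr => i _.
  by rewrite mxE valK mulrC.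
by move: rt; rewrite horner_prod prodf_seq_neq0 => /allP/(_ w ws).
Qed.

Definition line_polynomial (N : nat) (f : 'rV[R]_d -> R) :=
  forall y q, exists2 r : {poly R}, (size r <= N)%N &
    forall t, r.[t] = f (y + t *: q).

(* A generic line through x0 meets distinct hyperplanes in distinct points, so
   f vanishes on at most [N - 1] of them. *)
Lemma finite_zero_hyperplanes (N : nat) (f : 'rV[R]_d -> R) x0 :
  line_polynomial N f -> f x0 != 0 ->
  finite_set [set w | dotmul x0 w = 1 /\ forall y, dotmul y w = 0 -> f y = 0].
Proof.
move=> fN f0; apply: contrapT => /(infinite_set_fset N)[B BH NB].
(* Genericity of the direction q: the line meets every hyperplane of B, since q is orthogonal to no
   w, and at distinct parameters, since q is orthogonal to no difference. *)
have [q Bq] : exists q, all (fun w => dotmul q w != 0)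
    ([seq w <- [seq w - w' | w <- B, w' <- B] | w != 0] ++ B).
  apply: exists_nonorthogonal; rewrite all_cat filter_all /=.
  apply/allP => w /BH /= [x0w _]; apply: contra_eq_neq x0w => ->.
  by rewrite dotmul0r eq_sym oner_neq0.
move: Bq; rewrite all_cat => /andP[/allP Bq1 /allP Bq2].
have [r rN rE] := fN x0 q.
have r0 : r != 0.
  by apply: contra_neq f0 => E; have := rE 0; rewrite E horner0 scale0r addr0.
(* These are the parameters at which the line through x0 meets the hyperplanes. There are at least N
   of them, too many for r. *)
have := @max_poly_roots _ r [seq - (dotmul q w)^-1 | w <- B] r0.
rewrite size_map; suff H : forall a b : bool, a -> b ->
    (a -> b -> (size B < size r)%N) -> False.
  move=> H1; apply: (H _ _ _ _ H1).
    apply/allP => _ /mapP[w wB ->]; have [x0w fw] := BH _ wB.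
    apply/rootP; rewrite rE; apply: fw.
    by rewrite dotmulDl dotmulZl x0w mulNr mulVf ?subrr // Bq2.
  rewrite map_inj_in_uniq ?fset_uniq // => w w' wB w'B /oppr_inj/invr_inj E.
  apply/eqP; rewrite -subr_eq0; apply: contraT => ww'.
  have /Bq1 : w - w' \in [seq w <- [seq w - w' | w <- B, w' <- B] | w != 0].
    by rewrite mem_filter ww' /=; apply/allpairsP; exists (w, w').
  by rewrite dotmulBr E subrr eqxx.
by move=> a b -> -> /(_ isT isT); rewrite ltnNge (leq_trans rN NB).
Qed.

Lemma finite_set_mx (m n : nat) (E : set R) : finite_set E ->
  finite_set [set M : 'M[R]_(m, n) | forall i j, E (M i j)].
Proof.
move=> /finite_fsetP[X EX].
pose F (h : {ffun 'I_m * 'I_n -> X}) : 'M[R]_(m, n) :=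
  \matrix_(i, j) fsval (h (i, j)).
apply: (@sub_finite_set _ _ (F @` setT)); last first.
  exact: finite_image.
move=> M; rewrite EX /= => ME.
exists [ffun ij => [` ME ij.1 ij.2]%fset] => //.
by apply/matrixP => i j; rewrite !mxE ffunE.
Qed.

(** The columns of A are normals to the walls of the cone, and f stands for the dominant term read
    in orthonormal coordinates. Its zeros bound the number of mirrors, and its positivity keeps them
    out of the open cone. *)
Lemma is_weyl_chamber_cone (N : nat) (A : 'M[R]_d) (f : 'rV[R]_d -> R) :
  A \in unitmx -> line_polynomial N f ->
  (forall i y, f (y *m reflmx (row i A^T)) = - f y) ->
  (forall y, (forall i, 0 < (y *m A) 0 i) -> 0 < f y) ->
  is_weyl_chamber [set y | forall i, 0 <= (y *m A) 0 i].
Proof.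
move=> uA fN fodd fpos; pose u i := row i A^T.
have u0 i : u i != 0.
  apply/negP => /eqP ui; have := congr1 (fun v => v *m invmx A^T) ui.
  rewrite /u rowE mulmxK ?unitmx_tr // mul0mx => /rowP/(_ i)/eqP.
  by rewrite !mxE !eqxx oner_eq0.
pose T : set 'M[R]_d := [set M | exists i, M = reflmx (u i)].
pose W := smallest (@matrix_group R d) T.
have TO : T `<=` @orthogonal_group R d.
  by move=> _ [i ->]; exact: reflmx_orthogonal.
have gW : matrix_group W by exact: smallest_matrix_group.
have WO : W `<=` @orthogonal_group R d.
  by apply: smallest_sub => //; exact: orthogonal_matrix_group.
(* The orthogonal matrices that multiply f by their determinant form a group containing the
   generators. *)
have Wdet (g : 'M[R]_d) : W g -> forall y, f (y *m g) = \det g * f y.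
  move=> Wg; suff : [set g | @orthogonal_group R d g /\
      forall y, f (y *m g) = \det g * f y] g by case.
  move: g Wg; apply: smallest_sub.
    have [Oid OM OV] := @orthogonal_matrix_group R d.
    split=> [|g h [Og fg] [Oh fh]|g [Og fg]].
    - by split=> [|y]; [exact: Oid|rewrite mulmx1 det1 mul1r].
    - split=> [|y]; first exact: OM.
      by rewrite mulmxA fh fg det_mulmx mulrA [\det h * _]mulrC.
    - have [ug OVg] := OV g Og; split=> //; split=> // y.
      have := fg (y *m invmx g); rewrite mulmxKV // => ->.
      by rewrite det_inv mulKf // -unitfE -unitmxE.
  move=> _ [i ->]; split=> [|y]; first exact: reflmx_orthogonal.
  by rewrite fodd det_reflmx // mulN1r.
have Wmirror (x v : 'rV[R]_d) :
  v != 0 -> W (reflmx v) -> dotmul x v = 0 -> f x = 0.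
  move=> v0 Wv xv; have := Wdet _ Wv x;
    rewrite reflmx_fix // det_reflmx // mulN1r.
  by move=> /eqP; rewrite -addr_eq0 -mulr2n mulrn_eq0 => /eqP.
(* A point of the open cone, all of whose wall coordinates are 1. *)
pose x0 : 'rV[R]_d := const_mx 1 *m invmx A.
have x0A i : 0 < (x0 *m A) 0 i by rewrite mulmxKV // mxE.
have fx0 : f x0 != 0 by rewrite gt_eqF // fpos.
have finW : finite_set W.
  have finH := finite_zero_hyperplanes fN fx0.
  set H := [set w | _] in finH.
  (* The factor that gives w the length of [u i]. *)
  pose c i w := Num.sqrt (dotmul (u i) (u i) / dotmul w w).
  pose E := \bigcup_(ij in [set: 'I_d * 'I_d])
    ((fun w => c ij.1 w * w 0 ij.2) @` H `|` (fun w =>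
      - c ij.1 w * w 0 ij.2) @` H).
  have finE : finite_set E.
    apply: bigcup_finite => // ij _; rewrite finite_setU.
    by split; exact: finite_image.
  (* Each row of [A^T *m g] is normal to a mirror and as long as some [u i]. Rescaled to have
     product 1 with x0 it lies in the finite set H, from which length and sign recover it; so its
     entries take finitely many values. *)
  have EW g : W g -> forall i j, E ((A^T *m g) i j).
    move=> Wg i j; set v := u i *m g.
    have vij : (A^T *m g) i j = v 0 j by rewrite /v /u -row_mul [RHS]mxE.
    have Og := WO _ Wg; have ggT : g^T *m g = 1%:M by rewrite mulmx1C.
    have vv : dotmul v v = dotmul (u i) (u i).
      by rewrite /v dotmul_mulmxl -mulmxA Og mulmx1.
    have v0 : v != 0 by rewrite -dotmul_eq0 vv dotmul_eq0.
    have Wv : W (reflmx v).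
      rewrite reflmx_conj //; have [W1 WM WV] := gW.
      apply: (WM) => //; apply: (WM); last by apply: sub_gen_smallest; exists i.
      have -> : g^T = invmx g by rewrite -[RHS]mul1mx -ggT mulmxK //;
        case: (WV g Wg).
      by have [] := WV g Wg.
    have fv y : dotmul y v = 0 -> f y = 0 by apply: Wmirror.
    have x0v : dotmul x0 v != 0 by apply: contra_neq fx0; exact: fv.
    pose w := (dotmul x0 v)^-1 *: v.
    have Hw : H w.
      split=> [|y]; first by rewrite dotmulZr mulVf.
      move=> /eqP; rewrite dotmulZr mulf_eq0 invr_eq0 (negbTE x0v) /=.
      by move=> /eqP; exact: fv.
    have vw : v = dotmul x0 v *: w by rewrite scalerA divff // scale1r.
    have cw : c i w = `|dotmul x0 v|.
      rewrite /c -vv {1 2}vw dotmulZl dotmulZr mulrA mulfK -?expr2 ?sqrtr_sqr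
        //.
      by rewrite dotmul_eq0 scaler_eq0 invr_eq0 negb_or x0v v0.
    exists (i, j) => //=; rewrite vij vw mxE.
    have [x0vp|x0vn] := leP 0 (dotmul x0 v); [left|right]; exists w => //.
      by rewrite cw ger0_norm.
    by rewrite cw ltr0_norm ?opprK.
  apply: (sub_finite_set _ (finite_image (fun M => invmx A^T *m M)
     (finite_set_mx d d finE))) => g Wg.
  exists (A^T *m g); first exact: EW.
  by rewrite mulKmx ?unitmx_tr.
exists W.
  split=> //; exists T => // _ [i ->]; by exists (u i).
pose K := [set y : 'rV[R]_d | forall i, 0 < (y *m A) 0 i].
have KW : K `<=` ~` mirrors W.
  move=> y Ky [v [v0 Wv yv]]; have := fpos y Ky.
  by rewrite (Wmirror y v) // ltxx.
exists x0; first exact: KW.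
rewrite -(closure_open_cone x0A); congr closure.
apply/seteqP; split.
  apply: connected_component_max => //.
  apply: (@star_connected _ _ _ x0) => // y t Ky /andP[t0 t1] i.
  have -> : x0 + t *: (y - x0) = (1 - t) *: x0 + t *: y.
    by rewrite scalerBr scalerBl scale1r addrA addrAC.
  rewrite mulmxDl -!scalemxAl mxE [X in X + _]mxE [X in _ + X]mxE.
  have [->|t10] := eqVneq t 1; first by rewrite subrr mul0r add0r mul1r;
    exact: Ky.
  have {t10}t1 : t < 1 by rewrite lt_neqAle t10.
  apply: ltr_pwDl; first by rewrite mulr_gt0 // subr_gt0.
  by rewrite mulr_ge0 // ltW.
move=> y Ky i.
(* A wall coordinate vanishes only on a mirror, so it keeps its sign on the component of x0. *)
apply: (@connected_sign _ _ (connected_component (~` mirrors W) x0) x0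
  (fun y => (y *m A) 0 i)) => //.
- exact: component_connected.
- exact: mulmx_coord_continuous.
- move=> z /connected_component_sub zW; apply/eqP => zi; apply: zW.
  exists (u i); split=> //; first by apply: sub_gen_smallest; exists i.
  by rewrite dotmul_row.
- by apply: connected_component_refl; exact: KW.
Qed.

End FiniteReflectionGroup.

(** * Square roots of positive definite matrices *)

Section SquareRoot.
Variables (R : realType) (d : nat).
Implicit Types (M Q : 'M[R]_d).

Lemma posdefmx_unit M : posdefmx M -> M \in unitmx.
Proof.
move=> [_ Mpos]; rewrite -row_free_unit -kermx_eq0;
  apply/rowV0P => x /sub_kermxP xM.
apply/eqP; apply: contraT => /Mpos.
by rewrite xM dotmul0l ltxx.
Qed.

(** Newton interpolation: the value at a new node is corrected by a multiple of the polynomial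
    vanishing at the earlier nodes. *)
Lemma poly_interpolation (s : seq R) (g : R -> R) :
  exists p : {poly R}, forall t, t \in s -> p.[t] = g t.
Proof.
elim: s => [|x s [p IH]]; first by exists 0.
have [xs|xs] := boolP (x \in s).
  by exists p => t; rewrite inE => /orP[/eqP ->|]; exact: IH.
pose q := \prod_(y <- s) ('X - y%:P).
have qx : q.[x] != 0 by rewrite -[_ == 0]/(root q x) root_prod_XsubC.
exists (p + ((g x - p.[x]) / q.[x]) *: q) => t; rewrite !hornerE.
have [-> _|tx] := eqVneq t x; first by rewrite divfK // addrC subrK.
rewrite inE (negbTE tx) /= => ts; rewrite IH //.
have /rootP -> : root q t by rewrite root_prod_XsubC.
by rewrite mulr0 addr0.
Qed.

Lemma trmx_horner_mx (n : nat) (M : 'M[R]_n.+1) (p : {poly R}) :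
  (horner_mx M p)^T = horner_mx M^T p.
Proof.
elim/poly_ind: p => [|p c IH]; first by rewrite !rmorph0 trmx0.
rewrite !(rmorphD, rmorphM) /= !horner_mx_X !horner_mx_C linearD /=
  tr_scalar_mx.
by rewrite -!mulmxE trmx_mul IH comm_horner_mx.
Qed.
End SquareRoot.

(* [r] interpolates the fourth root on the spectrum of M, which is real and
   positive, so that [T = r(M)] is symmetric and [T ^ 2] is the square root. *)
Lemma posdefmx_sqrt (R : realType) (d : nat) (M : 'M[R]_d) :
  posdefmx M -> exists Q, posdefmx Q /\ Q *m Q = M.
Proof.
case: d M => [|d] M posM.
  by exists M; split=> //; apply/matrixP => -[].
have [Msym Mpos] := posM.
pose toC := real_complex R; pose MC := map_mx toC M.
have MCn : MC \is hermitianmx _ false Num.conj.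
  apply/is_hermitianmxP; rewrite expr0 scale1r; apply/matrixP => i j.
  rewrite !mxE; have -> : M j i = M i j by rewrite -{1}Msym mxE.
  by apply/esym/CrealP; apply/complex_realP; exists (M i j).
have /orthomx_spectralP := hermitian_normalmx MCn.
have := hermitian_spectral_diag_real MCn.
have := spectral_unit MC.
move: (spectralmx MC) (spectral_diag MC) => P sp uP /mxOverP spr MCE.
pose lam k := complex.Re (sp 0 k).
have lamE k : sp 0 k = toC (lam k) by rewrite /lam /toC RRe_real.
have lam_gt0 k : 0 < lam k.
  pose v := row k P.
  have v0 : v != 0.
    apply/negP => /eqP v0; have := congr1 (mulmx^~ (invmx P)) v0.
    rewrite /v rowE mulmxK // mul0mx => /rowP/(_ k)/eqP.
    by rewrite !mxE !eqxx oner_eq0.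
  have vM : v *m MC = toC (lam k) *: v.
    rewrite MCE /v rowE !mulmxA mulmxK // -!rowE row_diag_mx -lamE -scalemxAl.
    by rewrite -rowE.
  (* Applied to the real and imaginary parts: M and the eigenvalue being real, each part of v
     satisfies the eigenvalue equation, and one of them is nonzero. *)
  have part (f : complex R -> R) : {morph f : z w / z + w} -> f 0 = 0 ->
      (forall z t, f (z * toC t) = f z * t) ->
      map_mx f v *m M = lam k *: map_mx f v.
    move=> fD f0 fZ; apply/rowP => i;
      have := congr1 (fun u : 'rV[complex R]_d.+1 => f (u 0 i)) vM.
    rewrite !mxE (big_morph f fD f0) [in RHS]mulrC fZ mulrC => <-.
    by apply: eq_bigr => j _; rewrite !mxE fZ.
  have [x [x0 xM]] : exists x : 'rV[R]_d.+1, x != 0 /\ x *m M = lam k *: x.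
    have [re0|re0] := eqVneq (map_mx (@complex.Re R) v) 0; last first.
      exists (map_mx (@complex.Re R) v); split=> //.
      by apply: part => [[? ?] [? ?]|//|[? ?] ?] //=; rewrite mulr0 subr0.
    exists (map_mx (@complex.Im R) v); split; last first.
      by apply: part => [[? ?] [? ?]|//|[? ?] ?] //=; rewrite mulr0 add0r.
    apply: contra_neq v0 => im0; apply/rowP => j; apply/eqP.
    have := congr1 (fun u : 'rV[R]_d.+1 => u 0 j) re0.
    have := congr1 (fun u : 'rV[R]_d.+1 => u 0 j) im0.
    by rewrite eq_complex !mxE /= => -> ->; rewrite eqxx.
  have := Mpos x x0; rewrite xM dotmulZl pmulr_lgt0 // dotmul_gt0 //; exact.
have [r rE] := poly_interpolation [seq lam k | k <- enum 'I_d.+1]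
  (fun t => Num.sqrt (Num.sqrt t)).
pose T := horner_mx M r.
have T4 : (T *m T) *m (T *m T) = M.
  (* This polynomial vanishes on the spectrum, hence at M by diagonalization over the complex
     numbers. *)
  have : horner_mx M (r ^+ 4 - 'X) = 0.
    apply: (@map_mx_inj _ _ toC); rewrite map_mx0 map_horner_mx -/MC {1}MCE.
    rewrite horner_mx_uconjC // horner_mx_diag.
    have -> : diag_mx (map_mx (horner (map_poly toC (r ^+ 4 - 'X))) sp) = 0.
      apply/matrixP => k l; rewrite !mxE lamE horner_map !hornerE rE;
        last first.
        by apply/mapP; exists k; rewrite ?mem_enum.
      by rewrite (exprM _ 2 2) !sqr_sqrtr ?sqrtr_ge0 ?ltW ?subrr ?rmorph0
        ?mul0rn.
    by rewrite mulmx0 mul0mx.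
  rewrite rmorphB rmorphXn /= horner_mx_X => /eqP; rewrite subr_eq0 => /eqP <-.
  by rewrite !mulmxE -/T !exprS expr0 mulr1 !mulrA.
have Tsym : T^T = T by rewrite /T trmx_horner_mx Msym.
have uT : T \in unitmx.
  have := posdefmx_unit posM; rewrite -T4 !unitmx_mul.
  by case/andP => /andP[].
exists (T *m T); split=> //; split=> [|x x0]; first by rewrite trmx_mul Tsym.
rewrite mulmxA dotmul_mulmxl Tsym dotmul_gt0; apply: contra_neq x0 => xT.
by rewrite -[x](mulmxK uT) xT mul0mx.
Qed.

Lemma sqrtmxP (R : realType) (d : nat) (M : 'M[R]_d) :
  posdefmx M -> posdefmx (sqrtmx M) /\ sqrtmx M *m sqrtmx M = M.
Proof.
move=> /posdefmx_sqrt[Q QM].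
exact: (@xgetPex _ 0 [set Q | posdefmx Q /\ Q *m Q = M] (ex_intro _ Q QM)).
Qed.

(** * From a+-polynomials to Weyl chambers *)

(** Any move from x against the i-th basis vector leaves the orthant. *)
Lemma boundary_orthant (R : realType) (d : nat) (x : 'rV[R]_d) i :
  orthant x -> x 0 i = 0 -> boundary (@orthant R d) x.
Proof.
move=> x0 xi; split; first exact: subset_closure.
move=> /= xint.
have : \forall t \near (0 : R)^'+, orthant (x + t *: - delta_mx 0 i).
  have : (fun t : R => x + t *: - delta_mx 0 i) @ (0 : R)^'+ --> x.
    apply: cvg_at_right_filter; rewrite -[X in _ --> X]addr0.
    rewrite -(scale0r (- delta_mx 0 i)).
    exact: segment_continuous.
  by move=> /(_ _ xint).
move=> xt; near (0 : R)^'+ => t.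
have : orthant (x + t *: - delta_mx 0 i) by near: t.
move=> /(_ i); rewrite !mxE xi !eqxx mulrN1 add0r oppr_ge0 leNgt.
by move/negP; apply; near: t; exact: nbhs_right_gt.
Unshelve. all: by end_near.
Qed.

Lemma posdefmx_diag_gt0 (R : realType) (d : nat) (M : 'M[R]_d) i :
  posdefmx M -> 0 < M i i.
Proof.
move=> [_ /(_ (delta_mx 0 i))].
have -> : delta_mx 0 i != 0 :> 'rV[R]_d.
  by apply/eqP => /rowP/(_ i)/eqP; rewrite !mxE !eqxx oner_eq0.
move=> /(_ isT); rewrite -rowE dotmulE (bigD1 i) //= big1 => [|j ji].
  by rewrite !mxE !eqxx mulr1 addr0.
by rewrite [delta_mx _ _ _ _]mxE eqxx (negbTE ji) mulr0.
Qed.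

Section CovarianceCone.
Variables (R : realType) (d : nat).
Variables (S : {fset 'rV[R]_d}) (a : 'rV[R]_d -> R).
Hypothesis hcov : posdefmx (covmx S a).

Definition stddev i : R := Num.sqrt (\sum_(s <- S) a s * s 0 i ^+ 2).

(** Right multiplication by this matrix carries the cone C onto the orthant. The diagonal factor
    leaves the cone unchanged and makes the Gram matrix of the columns equal to Sigma. *)
Definition wallmx : 'M[R]_d := sqrtmx (covmx S a) *m diag_mx (\row_i stddev i).

Lemma stddev_gt0 i : 0 < stddev i.
Proof.
rewrite lt_neqAle sqrtr_ge0 andbT eq_sym; apply/eqP => si.
have := posdefmx_diag_gt0 i hcov.
by rewrite mxE -/(stddev i) si !(mulr0, invr0) ltxx.
Qed.

Lemma moment_cov i j :
  momentmx S a i j = stddev i * covmx S a i j * stddev j.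
Proof.
rewrite !mxE -/(stddev i) -/(stddev j).
by have := stddev_gt0 i; have := stddev_gt0 j => *; field; lra.
Qed.

Lemma sqrtcov_unit : sqrtmx (covmx S a) \in unitmx.
Proof. by have [/posdefmx_unit] := sqrtmxP hcov. Qed.

Lemma wallmx_unit : wallmx \in unitmx.
Proof.
rewrite unitmx_mul sqrtcov_unit unitmxE det_diag unitfE prodf_seq_neq0.
by apply/allP => i _ /=; rewrite mxE gt_eqF // stddev_gt0.
Qed.

Lemma wallmx_gram : wallmx^T *m wallmx = momentmx S a.
Proof.
have [[Qsym _] QQ] := sqrtmxP hcov.
rewrite /wallmx trmx_mul tr_diag_mx Qsym mulmxA -(mulmxA (diag_mx _)) QQ.
apply/matrixP => i j; rewrite moment_cov mul_mx_diag mxE mul_diag_mx !mxE.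
by [].
Qed.

Lemma wallmx_coord (y : 'rV[R]_d) i :
  (y *m wallmx) 0 i = (y *m sqrtmx (covmx S a)) 0 i * stddev i.
Proof. by rewrite /wallmx mulmxA mul_mx_diag !mxE. Qed.

Lemma walk_coneE :
  walk_cone S a = [set y | forall i, 0 <= (y *m wallmx) 0 i].
Proof.
have uQ := sqrtcov_unit; rewrite /walk_cone /invsqrt_cov.
apply/seteqP; split=> [_ [x x0 <-] i|y yA].
  by rewrite wallmx_coord mulmxKV // mulr_ge0 // ltW ?stddev_gt0.
exists (y *m sqrtmx (covmx S a)); last by rewrite mulmxK.
by move=> i; move: (yA i); rewrite wallmx_coord pmulr_lge0 // stddev_gt0.
Qed.

Hypothesis ha_sum1 : \sum_(s <- S) a s = 1.
Hypothesis ha_drift0 : \sum_(s <- S) a s *: s = 0.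

Lemma aplus_weyl_chamber (P : mpoly d R) :
  aplus_polynomial S a P -> is_weyl_chamber (walk_cone S a).
Proof.
move=> [P0 Pharm Pbound Ppos].
have polyE (v : 'I_d -> R) p : meval v p = poly_fun p (\row_i v i).
  by apply: meval_eq => i; rewrite mxE.
have lapP : mlap S a P = 0.
  apply: mpoly_eq0_on_nneg => v v0; have := Pharm (\row_i v i).
  rewrite polyE /laplacian /poly_fun -meval_mlap; apply.
  by move=> i; rewrite mxE.
(* Harmonicity on the orthant has become a polynomial identity, so the dominant term can be
   extracted. *)
set H := dominant_term P in Ppos.
have HM : quadder (momentmx S a) H = 0 by exact: mlap_quadder_dominant.
have Hi i : mvdvd i H.
  move=> m mi; rewrite /H /dominant_term mcoeff_pihomog; case: ifP => // _.
  apply: (@mvdvd_face _ _ i P) => // v v0 vi.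
  rewrite polyE; apply: Pbound.
  by apply: (@boundary_orthant _ _ _ i) => [j|]; rewrite mxE.
pose A := wallmx.
have gramE i j : momentmx S a i j = dotmul (row i A^T) (row j A^T).
  by rewrite -wallmx_gram -/A dotmul_row -row_mul [RHS]mxE.
rewrite walk_coneE.
apply: (@is_weyl_chamber_cone _ _ (mmeasure mdeg H) _
  (fun y => poly_fun H (y *m A))) => [|y q|i y|y yA].
- exact: wallmx_unit.
- exists (line ((y *m A) 0) ((q *m A) 0) H); first exact: size_line.
  move=> t; rewrite horner_line; apply: meval_eq => i.
  by rewrite mulmxDl -scalemxAl !mxE mulrC.
- have Mii : momentmx S a i i != 0.
    by rewrite moment_cov !mulf_neq0 ?gt_eqF ?stddev_gt0 ?posdefmx_diag_gt0.
  set z := y *m A; pose c j := momentmx S a i j / momentmx S a i i.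
  have ci : c i = 1 by rewrite /c divff.
  (* The base point z - z_i c lies on the hyperplane because c i = 1. Adding z_i c gives back z;
     subtracting it gives the image of y under the wall reflection, in the coordinates of the
     orthant. *)
  have := @quadder_harmonic_odd _ _ i (momentmx S a) H
    (fun j => z 0 j - c j * z 0 i) (z 0 i) (momentmx_tr _ _) Mii (Hi i) HM.
  rewrite ci mul1r subrr => /(_ erefl) E.
  have -> : poly_fun H z = meval (fun j =>
      z 0 j - c j * z 0 i + momentmx S a i j / momentmx S a i i * z 0 i) H.
    by apply: meval_eq => j; rewrite subrK.
  rewrite -E; apply: meval_eq => j.
  rewrite mulmx_reflmx mulmxBl -scalemxAl -/z -gramE dotmul_row -/z.
  have subZE (u v : 'rV[R]_d) k : (u - k *: v) 0 j = u 0 j - k * v 0 j.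
    by rewrite !mxE.
  by rewrite -row_mul wallmx_gram subZE [row _ _ 0 j]mxE /c; ring.
- by apply: Ppos.
Qed.

End CovarianceCone.

(** * Planar Weyl chambers *)

Section WeylChamberWalls.
Variables (R : realType) (d : nat) (W : set 'M[R]_d).
Implicit Types (x y u v w : 'rV[R]_d).

Lemma closed_halfspace u : closed [set y | 0 <= dotmul y u].
Proof.
apply: (@preimage_closed _ _ (fun y => dotmul y u) [set t | 0 <= t]).
  by move=> y _; exact: dotmul_continuous.
exact: closed_ge.
Qed.

(** A finite union of closed sets, once indexed by the reflections in W instead of their normals. *)
Lemma closed_mirrors : finite_set W -> closed (mirrors W).
Proof.
move=> finW.
have -> : mirrors W = \bigcup_(g in W `&` @reflections R d) [set x | x *m g =
  x].
  apply/seteqP; split=> [x [u [u0 Wu xu]]|x [g [Wg [u u0 gE]] xg]].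
    by exists (reflmx u); [split=> //; exists u|exact: reflmx_fix].
  by exists u; rewrite -gE; split=> //; apply: reflmx_fixP => //; rewrite -gE.
apply: closed_bigcup => [|_ [_ [u u0 ->]]].
  by apply: sub_finite_set finW => g [].
have -> : [set x | x *m reflmx u = x] = (fun x => dotmul x u) @^-1` [set 0].
  apply/seteqP; split=> x /=; [exact: reflmx_fixP|exact: reflmx_fix].
apply: preimage_closed; last exact: closed_eq.
by move=> y _; exact: dotmul_continuous.
Qed.

(** Off the mirrors, a whole ball around v would avoid them and meet the open chamber, hence lie in
    C; but the points v - t w leave C at once. *)
Lemma weyl_chamber_wall (C : set 'rV[R]_d) v w : finite_set W ->
  weyl_chamber_of W C -> C v -> (forall t, 0 < t -> ~ C (v - t *: w)) ->
  mirrors W v.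
Proof.
move=> finW [x Wx CE] Cv vw; apply: contrapT => Wv.
have /nbhs_ballP[e /= e0 ve] : nbhs v (~` mirrors W).
  by apply: open_nbhs_nbhs; split=> //; exact/closed_openC/closed_mirrors.
have cB : connected (ball v e).
  apply: (@star_connected _ _ _ v); first exact: ballxx.
  move=> y t; rewrite -!ball_normE /ball_ /= => vy /andP[t0 t1].
  rewrite opprD addNKr normrN normrZ ger0_norm // distrC.
  by apply: le_lt_trans vy; rewrite ler_piMl.
have [z [Kz Bz]] : (connected_component (~` mirrors W) x `&` ball v e) !=set0.
  by move: Cv; rewrite CE; apply; exact: nbhsx_ballx.
have BC : ball v e `<=` C.
  rewrite CE => y By; apply: subset_closure.
  rewrite (same_connected_component Kz).
  exact: (connected_component_max Bz ve cB).
have : \forall t \near (0 : R)^'+, ball v e (v + t *: - w).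
  have : (fun t : R => v + t *: - w) @ (0 : R)^'+ --> v.
    apply: cvg_at_right_filter; rewrite -[X in _ --> X]addr0 -(scale0r (- w)).
    exact: segment_continuous.
  by move=> /(_ _ (nbhsx_ballx v e e0)).
move=> Bt; near (0 : R)^'+ => t.
apply: (vw t); first by near: t; exact: nbhs_right_gt.
by apply: BC; rewrite -scalerN; near: t.
Unshelve. all: by end_near.
Qed.

(** The open chamber lies strictly on one side of each mirror, so its closure lies weakly on that
    side. *)
Lemma weyl_chamber_side (C : set 'rV[R]_d) u v w :
  weyl_chamber_of W C -> u != 0 -> W (reflmx u) -> C v -> C w ->
  dotmul v u < 0 -> dotmul w u <= 0.
Proof.
move=> [x Wx CE] u0 Wu Cv Cw vu; rewrite leNgt; apply/negP => wu.
have Ku y : connected_component (~` mirrors W) x y -> dotmul y u != 0.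
  move=> /connected_component_sub yW; apply/eqP => yu; apply: yW.
  by exists u; split.
have Kx : connected_component (~` mirrors W) x x.
  exact: connected_component_refl.
have side u' y : (forall z, connected_component (~` mirrors W) x z ->
    dotmul z u' != 0) -> 0 < dotmul x u' -> C y -> 0 <= dotmul y u'.
  move=> Ku' xu'; rewrite CE => Cy; apply: (@closed_halfspace u').
  apply: closureS Cy => z Kz; apply/ltW.
  exact: (connected_sign (@component_connected _ _ _)
    (@dotmul_continuous _ _ u') Ku' Kx xu' Kz).
have [xu|xu] := ltP 0 (dotmul x u).
  by have := side u v Ku xu Cv; rewrite leNgt vu.
have Nu y : dotmul y (- u) = - dotmul y u by rewrite -scaleN1r dotmulZr mulN1r.
have : 0 <= dotmul w (- u).
  apply: side => // [z Kz|]; first by rewrite Nu oppr_eq0 Ku.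
  by rewrite Nu oppr_gt0 lt_neqAle Ku.
by rewrite Nu oppr_ge0 leNgt wu.
Qed.

End WeylChamberWalls.

Lemma ord2P (i : 'I_2) : i = 0 \/ i = 1.
Proof. by case: i => [[|[|]]] // i; [left|right]; apply: val_inj. Qed.

(* [nrm phi] is normal to the line of angle [phi] in the orthonormal frame
   (e, e'). The angles of the mirrors are stable under the reflections
   [phi |-> 2 psi - phi], contain 0, theta and pi, and avoid ]0, theta[; hence
   they are the multiples of theta, one of which is pi. *)
Lemma weyl_sector_angle (R : realType) (W : set 'M[R]_2) (C : set 'rV[R]_2)
    (v1 v2 : 'rV[R]_2) :
  finite_coxeter_group W -> weyl_chamber_of W C -> C v1 -> C v2 ->
  (forall t, 0 < t -> ~ C (v1 - t *: v2)) ->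
  (forall t, 0 < t -> ~ C (v2 - t *: v1)) ->
  v1 != 0 -> v2 != 0 ->
  -1 < dotmul v1 v2 / (enorm v1 * enorm v2) < 1 ->
  exists2 n : nat, (0 < n)%N & angle v1 v2 = pi / n%:R.
Proof.
move=> [finW WO [_ WM _] _] WC Cv1 Cv2 v12 v21 v10 v20.
rewrite /angle; set c := (_ / _) => /andP[c1 c2].
set th := acos c.
have cth : cos th = c by rewrite acosK // in_itv /= !ltW.
have th0 : 0 < th by rewrite acos_gt0 // ltW.
have thpi : th < pi by rewrite acos_ltpi // c1 ltW.
have sth : 0 < sin th by apply: sin_gt0_pi; rewrite th0.
have en_gt0 (v : 'rV[R]_2) : v != 0 -> 0 < enorm v.
  by move=> v0; rewrite sqrtr_gt0 dotmul_gt0.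
have enE (v : 'rV[R]_2) : dotmul v v = enorm v ^+ 2.
  by rewrite sqr_sqrtr ?dotmul_ge0.
have l1 := en_gt0 _ v10; have l2 := en_gt0 _ v20.
have d12 : dotmul v1 v2 = c * (enorm v1 * enorm v2).
  by rewrite divfK // mulf_neq0 ?gt_eqF.
pose e := (enorm v1)^-1 *: v1.
have ee : dotmul e e = 1.
  by rewrite /e !(dotmulZl, dotmulZr) enE; field; rewrite gt_eqF.
have ev2 : dotmul e v2 = c * enorm v2.
  by rewrite /e dotmulZl d12; field; rewrite gt_eqF.
have v1E : v1 = enorm v1 *: e by rewrite scalerA divff ?scale1r ?gt_eqF.
clearbody e.
(* Gram-Schmidt: e points along v1, and v2 has angle th in the frame (e, e'). *)
pose e' := (sin th)^-1 *: ((enorm v2)^-1 *: v2 - c *: e).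
have ee' : dotmul e e' = 0.
  by rewrite /e' !(dotmulZr, dotmulBr) ev2 ee; field; rewrite !gt_eqF.
have e'e' : dotmul e' e' = 1.
  rewrite {1}/e' dotmulZl dotmulBl !dotmulZl ee' mulr0 subr0 /e'.
  rewrite dotmulZr dotmulBr !dotmulZr enE (dotmulC v2 e) ev2.
  have : sin th ^+ 2 = 1 - c ^+ 2 by rewrite -cth -(cos2Dsin2 th) addrC addKr.
  by move=> s2; field: s2; rewrite !gt_eqF.
have v2E : v2 = enorm v2 *: (cos th *: e + sin th *: e').
  by rewrite cth /e' scalerA divff ?gt_eqF // scale1r addrC subrK scalerA
    divff ?scale1r ?gt_eqF.
clearbody e'.
pose nrm (phi : R) := - sin phi *: e + cos phi *: e'.
have nrm_dot phi psi : dotmul (nrm phi) (nrm psi) = cos (phi - psi).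
  rewrite /nrm !(dotmulDl, dotmulDr, dotmulZl, dotmulZr) (dotmulC e' e).
  by rewrite ee ee' e'e' cosB; ring.
have nrm0 phi : nrm phi != 0.
  by rewrite -dotmul_eq0 nrm_dot subrr cos0 oner_eq0.
(* Up to sign, which reflections ignore, the mirror of angle psi exchanges the angles psi - dl and
   psi + dl. *)
have nrm_refl psi dl : nrm (psi - dl) *m reflmx (nrm psi) = -1 *:
  nrm (psi + dl).
  rewrite mulmx_reflmx !nrm_dot subrr cos0 divr1.
  have -> : psi - dl - psi = - dl by ring.
  by apply/rowP => i; rewrite cosN !mxE !(sinB, sinD, cosB, cosD); ring.
pose A phi := W (reflmx (nrm phi)).
have Arefl psi dl : A psi -> A (psi - dl) -> A (psi + dl).
  move=> Apsi Adl; rewrite /A -(reflmxZ _ (_ : -1 != 0)) ?oppr_eq0 ?oner_eq0 //.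
  rewrite -nrm_refl reflmx_conj; last exact: reflmx_orthogonal.
  by rewrite reflmx_sym; apply: (WM) => //; apply: (WM).
have frame (u : 'rV[R]_2) : u = dotmul u e *: e + dotmul u e' *: e'.
  pose B : 'M[R]_2 := \matrix_(i, j) (if i == 0 then e 0 j else e' 0 j).
  have r0 : row 0 B = e by apply/rowP => j; rewrite !mxE.
  have r1 : row 1 B = e' by apply/rowP => j; rewrite !mxE.
  have BE (x : 'rV[R]_2) i : (x *m B^T) 0 i = dotmul x (row i B).
    by rewrite -dotmul_row trmxK.
  have BB : B *m B^T = 1%:M.
    apply/matrixP => i j; transitivity ((row i B *m B^T) 0 j).
      by rewrite -row_mul [RHS]mxE.
    rewrite BE [RHS]mxE.
    by case: (ord2P i) => ->; case: (ord2P j) => ->;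
      rewrite ?r0 ?r1 ?ee ?e'e' ?ee' ?(dotmulC e') ?ee'.
  rewrite -{1}[u]mulmx1 -(mulmx1C BB) mulmxA mulmx_sum_row big_ord_recl
    big_ord1.
  have -> : lift ord0 ord0 = 1 :> 'I_2 by apply/val_inj.
  by rewrite !BE r0 r1.
(* The edge v1 lies on some mirror, whose normal is orthogonal to e and thus proportional to e'. *)
have A0 : A 0.
  have [u [u0 Wu]] := weyl_chamber_wall finW WC Cv1 v12.
  rewrite v1E dotmulZl => /eqP; rewrite mulf_eq0 gt_eqF //= dotmulC => /eqP ue.
  have u'0 : dotmul u e' != 0.
    by apply: contra_neq u0 => ue'; rewrite (frame u) ue ue' !scale0r addr0.
  rewrite /A /nrm sin0 cos0 oppr0 scale0r add0r scale1r.
  by rewrite -(reflmxZ e' u'0) -[_ *: e'](add0r) -(scale0r e) -ue -frame.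
have Ath : A th.
  have [u [u0 Wu]] := weyl_chamber_wall finW WC Cv2 v21.
  rewrite v2E dotmulZl => /eqP; rewrite mulf_eq0 gt_eqF //= dotmulC.
  rewrite dotmulDr !dotmulZr => /eqP ue.
  pose k := dotmul u e' * cos th - dotmul u e * sin th.
  have uE : u = k *: nrm th.
    rewrite {1}(frame u) /nrm scalerDr !scalerA /k; congr (_ *: _ + _ *: _);
      apply/eqP; rewrite -subr_eq0; apply/eqP; move: ue;
      set x := dotmul u e; set y := dotmul u e'; rewrite addrC => ue.
      transitivity (x * (1 - (cos th ^+ 2 + sin th ^+ 2)) +
        cos th * (sin th * y + cos th * x)); first by ring.
      by rewrite cos2Dsin2 ue subrr !mulr0 addr0.
    transitivity (y * (1 - (cos th ^+ 2 + sin th ^+ 2)) +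
      sin th * (sin th * y + cos th * x)); first by ring.
    by rewrite cos2Dsin2 ue subrr !mulr0 addr0.
  rewrite /A -(reflmxZ _ (_ : k != 0)) -?uE //.
  by apply: contra_neq u0 => k0; rewrite uE k0 scale0r.
(* A mirror at such an angle would separate v1 from v2 strictly. *)
have Nth phi : 0 < phi -> phi < th -> ~ A phi.
  move=> p0 pth Aphi.
  have := weyl_chamber_side WC (nrm0 phi) Aphi Cv1 Cv2.
  have sp : 0 < sin phi by apply: sin_gt0_pi; rewrite p0 (lt_trans pth).
  have stp : 0 < sin (th - phi).
    by apply: sin_gt0_pi; rewrite subr_gt0 pth ltrBlDr (lt_trans thpi) // ltrDl.
  rewrite v1E v2E /nrm !(dotmulZl, dotmulDl, dotmulDr, dotmulZr) (dotmulC e' e).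
  rewrite ee ee' e'e' !mulr0 !addr0 !add0r !mulr1.
  rewrite pmulr_rlt0 // oppr_lt0 => /(_ sp); rewrite pmulr_rle0 //.
  rewrite leNgt mulrN addrC [_ * sin phi]mulrC.
  by move: stp; rewrite sinB [cos th * _]mulrC => ->.
have Amul k : A (k%:R * th).
  suff : A (k%:R * th) /\ A (k.+1%:R * th) by case.
  elim: k => [|k [IH1 IH2]]; first by rewrite mul0r mul1r.
  split=> //; have -> : k.+2%:R * th = k.+1%:R * th + th by rewrite -!natr1;
    ring.
  apply: Arefl => //; have -> // : k.+1%:R * th - th = k%:R * th.
  by rewrite -!natr1; ring.
(* The reflection in the mirror of angle (k+1) th moves each gap to the preceding one. *)
have Nmul k phi : k%:R * th < phi -> phi < k.+1%:R * th -> ~ A phi.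
  elim: k phi => [|k IH] phi; first by rewrite mul0r mul1r; exact: Nth.
  rewrite -!natr1 => p1 p2 Aphi.
  pose psi := k.+1%:R * th.
  apply: (IH (psi + (psi - phi))).
  - by rewrite /psi -!natr1; lra.
  - by rewrite /psi -!natr1; lra.
  - by apply: Arefl; [exact: Amul|rewrite opprB addrC subrK].
have Api : A pi.
  rewrite /A; have -> : nrm pi = -1 *: nrm 0.
    by rewrite /nrm sinpi cospi sin0 cos0 !oppr0 !scale0r !add0r scaleN1r
      scale1r
      scaleN1r.
  by rewrite reflmxZ // oppr_eq0 oner_eq0.
(* Were pi not equal to k th, it would fall strictly between two consecutive multiples of th. *)
pose k := Num.trunc (pi / th).
have /andP[k1 k2] : k%:R <= pi / th < k.+1%:R.
  by apply: truncn_itv; rewrite divr_ge0 ?pi_ge0 // ltW.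
have kpi : k%:R * th = pi.
  apply/eqP; rewrite eq_le -ler_pdivlMr // k1 /= leNgt; apply/negP => kp.
  by apply: (Nmul k pi) => //; rewrite -ltr_pdivrMr.
have k0 : (0 < k)%N.
  by rewrite lt0n; apply/eqP => k0; have := pi_gt0 R;
    rewrite -kpi k0 mul0r ltxx.
exists k => //; apply: (canRL (mulfK _)); last by rewrite mulrC.
by rewrite pnatr_eq0 -lt0n.
Qed.

(** * The planar cone and its angle *)

Section PlanarCone.
Variables (R : realType).
Variables (S : {fset 'rV[R]_2}) (a : 'rV[R]_2 -> R).
Hypothesis hcov : posdefmx (covmx S a).

Lemma big_ord2_neq (V : nmodType) (F : 'I_2 -> V) i j :
  i != j -> \sum_k F k = F i + F j.
Proof.
move=> ij; rewrite (bigD1 i) //= (bigD1 j) 1?eq_sym //= big1 ?addr0 // => k.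
by move: ij; case: (ord2P i) => ->; case: (ord2P j) => ->;
  case: (ord2P k) => ->.
Qed.

Lemma covmx_diag i : covmx S a i i = 1.
Proof.
have si := stddev_gt0 hcov i; rewrite mxE -/(stddev S a i) -expr2.
rewrite (_ : \sum_(s <- S) _ = stddev S a i ^+ 2).
  by rewrite divff // sqrf_eq0 gt_eqF.
rewrite sqr_sqrtr; last by move: si; rewrite sqrtr_gt0 => /ltW.
by apply: eq_bigr => s _; rewrite -mulrA.
Qed.

(** The Gram matrix K of the edges is the inverse of the covariance matrix, whose diagonal is 1 and
    off-diagonal entry r; so K has diagonal 1/(1 - r^2) and off-diagonal entry -r/(1 - r^2). *)
Lemma gram_cone_edges i j : i != j ->
  exists2 k : R, 0 < k &
  [/\ forall l, dotmul (delta_mx 0 l *m invsqrt_cov S a)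
        (delta_mx 0 l *m invsqrt_cov S a) = k,
      dotmul (delta_mx 0 i *m invsqrt_cov S a) (delta_mx 0 j *m invsqrt_cov S a)
        = - covmx S a i j * k &
      (1 - covmx S a i j ^+ 2) * k = 1].
Proof.
move=> ij; have uQ := sqrtcov_unit hcov; have [[Qsym _] QQ] := sqrtmxP hcov.
set M := invsqrt_cov S a; pose K := M *m M^T.
have dotE k l : dotmul (delta_mx 0 k *m M) (delta_mx 0 l *m M) = K k l.
  by rewrite dotmulC dotmul_mulmxl -mulmxA {1}/dotmul -!rowE !mxE.
have covsym k l : covmx S a k l = covmx S a l k.
  by have [<- _] := hcov; rewrite mxE; have [-> _] := hcov.
have KC : K *m covmx S a = 1%:M.
  rewrite /K /M /invsqrt_cov trmx_inv Qsym; set Q := sqrtmx _ in uQ QQ *.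
  rewrite -[X in _ *m X = _]QQ mulmxA -(mulmxA (invmx _)).
  by rewrite mulVmx // mulmx1 mulVmx.
have ji : j != i by rewrite eq_sym.
have Eij k l : K k i * covmx S a i l + K k j * covmx S a j l = (k == l)%:R.
  have := congr1 (fun N : 'M[R]_2 => N k l) KC.
  by rewrite mxE (big_ord2_neq _ ij) [in RHS]mxE.
have := Eij i j; have := Eij i i; have := Eij j i; have := Eij j j.
rewrite !covmx_diag (covsym j i) !eqxx (negbTE ij) (negbTE ji) !mulr1 /= mulr0n
  mulr1n.
set r := covmx S a i j => Ejj Eji Eii Eij'.
have Kij : K i j = - r * K i i by rewrite mulNr mulrC; lra.
have Kji : K j i = - r * K j j by rewrite mulNr mulrC; lra.
have Kii : (1 - r ^+ 2) * K i i = 1 by rewrite Kij in Eii; rewrite -[RHS]Eii;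
  ring.
have Kjj : (1 - r ^+ 2) * K j j = 1 by rewrite Kji in Ejj; rewrite -[RHS]Ejj;
  ring.
have r0 : 1 - r ^+ 2 != 0.
  by apply: contra_eq_neq Kii => ->; rewrite mul0r eq_sym oner_neq0.
have KE : K i i = K j j by apply: (mulfI r0); rewrite Kii Kjj.
have Ki0 : 0 < K i i.
  rewrite lt_neqAle -dotE dotmul_ge0 andbT dotE.
  by apply: contra_eq_neq Kii => <-; rewrite mulr0 eq_sym oner_neq0.
exists (K i i) => //; split=> [l||]; rewrite ?dotE //.
have [->|li] := eqVneq l i => //; rewrite KE.
by move: ij li; case: (ord2P i) => ->; case: (ord2P j) => ->;
  case: (ord2P l) => ->.
Qed.

Lemma cov_bounds i j : i != j -> -1 < - covmx S a i j < 1.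
Proof.
move=> ij; have [k k0 [_ _ E]] := gram_cone_edges ij.
have : 0 < 1 - covmx S a i j ^+ 2 by rewrite -(pmulr_lgt0 _ k0) E.
by rewrite subr_gt0 => ?; apply/andP; split; nra.
Qed.

Lemma cone_edges_cos i j : i != j ->
  dotmul (delta_mx 0 i *m invsqrt_cov S a) (delta_mx 0 j *m invsqrt_cov S a) /
  (enorm (delta_mx 0 i *m invsqrt_cov S a) *
   enorm (delta_mx 0 j *m invsqrt_cov S a)) = - covmx S a i j.
Proof.
move=> ij; have [k k0 [Ekk -> _]] := gram_cone_edges ij.
by rewrite /enorm !Ekk -expr2 sqr_sqrtr ?ltW // mulfK // gt_eqF.
Qed.

Lemma weyl_walk_cone_angle i j : i != j -> is_weyl_chamber (walk_cone S a) ->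
  exists2 n : nat, (0 < n)%N & walk_cone_angle S a i j = pi / n%:R.
Proof.
move=> ij [W WW WC]; set M := invsqrt_cov S a.
have uM : M \in unitmx by rewrite unitmx_inv sqrtcov_unit.
have edge k : walk_cone S a (delta_mx 0 k *m M).
  by exists (delta_mx 0 k) => // l; rewrite mxE ler0n.
have out k l : k != l -> forall t : R, 0 < t ->
    ~ walk_cone S a (delta_mx 0 k *m M - t *: (delta_mx 0 l *m M)).
  move=> kl t t0 [x x0]; rewrite scalemxAl -mulmxBl.
  move=> /(can_inj (mulmxK uM)) xE; have := x0 l.
  by rewrite xE !mxE !eqxx eq_sym (negbTE kl) /= sub0r mulr1 oppr_ge0 leNgt t0.
have edge0 k : delta_mx 0 k *m M != 0 :> 'rV[R]_2.
  apply/negP => /eqP /(congr1 (mulmx^~ (invmx M))); rewrite mulmxK // mul0mx.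
  by move=> /rowP/(_ k)/eqP; rewrite !mxE !eqxx oner_eq0.
apply: (weyl_sector_angle WW WC) => //; [exact: out|apply: out|].
  by rewrite eq_sym.
by rewrite cone_edges_cos // cov_bounds.
Qed.

End PlanarCone.

(** * Planar a+-polynomials *)

Section PlanarHarmonicPolynomials.
Variables (R : realType).
Implicit Types (P H : mpoly 2 R) (p q n k : nat).

Definition mn p q : multinom 2 :=
  mnm_add (mnm_muln (mnm1 0) p) (mnm_muln (mnm1 1) q).

Lemma mnE p q i : mn p q i = if i == 0 then p else q.
Proof.
rewrite mnmDE !mulmnE !mnm1E.
by case: (ord2P i) => -> /=; rewrite mul0n mul1n ?addn0.
Qed.

Lemma mn_eta (m : multinom 2) : m = mn (m 0) (m 1).
Proof. by apply/mnmP => i; rewrite mnE; case: (ord2P i) => ->. Qed.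

Lemma mdeg_mn p q : mdeg (mn p q) = (p + q)%N.
Proof. by rewrite mdegD !mdegMn !mdeg1 !mul1n. Qed.

Lemma mn_eq p q p' q' : (mn p q == mn p' q') = (p == p') && (q == q').
Proof.
apply/eqP/andP => [E|[/eqP -> /eqP ->] //].
by have := congr1 (fun m : multinom 2 => m 0) E;
  have := congr1 (fun m : multinom 2 => m 1) E; rewrite !mnE /= => -> ->.
Qed.

Variables (s0 s1 r : R) (N : 'M[R]_2).
Hypotheses (s0_gt0 : 0 < s0) (s1_gt0 : 0 < s1).
Hypotheses (N00 : N 0 0 = s0 ^+ 2) (N11 : N 1 1 = s1 ^+ 2).
Hypotheses (N01 : N 0 1 = r * s0 * s1) (N10 : N 1 0 = r * s0 * s1).

(* In these rescaled coefficients [quadder N] is the three-term recurrence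
   [b_(j+2) + 2 r b_(j+1) + b_j], solved by [sin (j theta)] when
   [r = - cos theta]. *)
Definition bcoef P p q : R :=
  mcoeff (mn p q) P * (p`!%:R * q`!%:R * s0 ^+ p * s1 ^+ q).

Lemma bcoef_eq0 P p q : bcoef P p q = 0 -> mcoeff (mn p q) P = 0.
Proof.
move=> /eqP; rewrite mulf_eq0 => /orP[/eqP //|].
by rewrite gt_eqF // !mulr_gt0 ?exprn_gt0 ?ltr0n ?fact_gt0.
Qed.

Lemma bcoef_quadder P p q : bcoef (quadder N P) p q =
  bcoef P p.+2 q + 2 * r * bcoef P p.+1 q.+1 + bcoef P p q.+2.
Proof.
have sum2 (F : 'I_2 -> R) : \sum_i F i = F 0 + F 1 by exact: big_ord2_neq.
rewrite /bcoef mcoeff_quadder sum2.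
rewrite [X in (X + _) * _ = _]sum2.
rewrite [X in (_ + X) * _ = _]sum2.
rewrite N00 N01 N10 N11.
have -> : mnm_add (mnm_add (mn p q) (mnm1 0)) (mnm1 0) = mn p.+2 q.
  by apply/mnmP => i; rewrite !(mnmDE, mulmnE, mnm1E);
    case: (ord2P i) => -> /=; lia.
have -> : mnm_add (mnm_add (mn p q) (mnm1 0)) (mnm1 1) = mn p.+1 q.+1.
  by apply/mnmP => i; rewrite !(mnmDE, mulmnE, mnm1E);
    case: (ord2P i) => -> /=; lia.
have -> : mnm_add (mnm_add (mn p q) (mnm1 1)) (mnm1 0) = mn p.+1 q.+1.
  by apply/mnmP => i; rewrite !(mnmDE, mulmnE, mnm1E);
    case: (ord2P i) => -> /=; lia.
have -> : mnm_add (mnm_add (mn p q) (mnm1 1)) (mnm1 1) = mn p q.+2.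
  by apply/mnmP => i; rewrite !(mnmDE, mulmnE, mnm1E);
    case: (ord2P i) => -> /=; lia.
rewrite !(mnmDE, mulmnE, mnm1E) /= !mul1n !mul0n !addn0 !add0n !addn1 !factS
  !natrM !exprS.
ring.
Qed.

Variable th : R.
Hypothesis rE : r = - cos th.

Lemma sin_rec j :
  sin (j.+2%:R * th) - 2 * cos th * sin (j.+1%:R * th) + sin (j%:R * th) = 0.
Proof.
have -> : j.+2%:R * th = j.+1%:R * th + th by rewrite -!natr1; ring.
have -> : j%:R * th = j.+1%:R * th - th by rewrite -!natr1; ring.
by rewrite sinD sinB; ring.
Qed.

(** Vanishing on one axis gives b_0 = 0, so the recurrence forces b_j sin th = b_1 sin (j th).
    Vanishing on the other gives b_k = 0, whence b_1 = 0 and then every b_j is 0. *)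
Lemma homog_quadder_eq0 k H :
  (forall j, (0 < j <= k)%N -> sin (j%:R * th) != 0) ->
  (forall m, mdeg m != k -> mcoeff m H = 0) ->
  (forall i, mvdvd i H) -> quadder N H = 0 -> H = 0.
Proof.
move=> sk Hk Hi HN; pose b j := bcoef H j (k - j).
have b0 : b 0%N = 0 by rewrite /b /bcoef (Hi 0) ?mul0r // ?mnE.
have bk : b k = 0 by rewrite /b /bcoef subnn (Hi 1) ?mul0r // ?mnE.
have brec j : (j.+2 <= k)%N -> b j.+2 - 2 * cos th * b j.+1 + b j = 0.
  move=> jk; have := bcoef_quadder H j (k - j.+2); rewrite HN.
  rewrite {1}/bcoef mcoeff0 mul0r rE /b => /esym.
  by rewrite -!subSn ?subSS ?mulrN ?mulNr // ltnW.
have bE j : (j.+1 <= k)%N -> b j * sin th = b 1%N * sin (j%:R * th) /\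
    b j.+1 * sin th = b 1%N * sin (j.+1%:R * th).
  elim: j => [_|j IH jk]; first by rewrite b0 !mul0r sin0 mulr0 mul1r.
  have [IH1 IH2] := IH (ltnW jk); split=> //.
  have := brec j jk; have := sin_rec j => E1 E2.
  have -> : b j.+2 = 2 * cos th * b j.+1 - b j by lra.
  have -> : sin (j.+2%:R * th) = 2 * cos th * sin (j.+1%:R * th) - sin (j%:R *
    th).
    by lra.
  transitivity (2 * cos th * (b j.+1 * sin th) - b j * sin th); first by ring.
  by rewrite IH1 IH2; ring.
apply/mpolyP => m; rewrite mcoeff0 [m]mn_eta.
set p := m 0; set q := m 1.
have [pq|pq] := eqVneq (p + q)%N k; last by apply: Hk; rewrite mdeg_mn.
have [k0|k0] := posnP k; first by apply: (Hi 0); rewrite mnE /=; lia.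
have sth : sin th != 0 by rewrite -[th]mul1r; apply: (sk 1%N); rewrite k0.
have b1 : b 1%N = 0.
  have [] := bE k.-1 _; first by rewrite prednK.
  rewrite prednK // bk mul0r => _ /esym/eqP; rewrite mulf_eq0.
  by rewrite (negbTE (sk k _)) ?k0 ?leqnn // orbF => /eqP.
apply: bcoef_eq0; have -> : q = (k - p)%N by lia.
have bp : b p * sin th = 0.
  have [->|p0] := posnP p; first by rewrite b0 mul0r.
  have [] := bE p.-1 _; first by lia.
  by rewrite prednK // b1 !mul0r => _ ->.
by apply/eqP; move/eqP: bp; rewrite mulf_eq0 (negbTE sth) orbF.
Qed.

(** The imaginary part of (x_1/s1 + e^(i th) x_0/s0)^n, a power of a linear form that is isotropic
    for the quadratic form of N when r = - cos th. *)
Definition sine_poly n : mpoly 2 R :=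
  \sum_(j < n.+1)
    ('C(n, j)%:R * sin (j%:R * th) / (s0 ^+ j * s1 ^+ (n - j)))
      *: mpolyX R (mn j (n - j)).

Lemma bcoef_sine_poly n p q :
  bcoef (sine_poly n) p q = (p + q == n)%N%:R * (n`!%:R * sin (p%:R * th)).
Proof.
rewrite /bcoef /sine_poly raddf_sum /=.
have [pq|pq] := eqVneq (p + q)%N n; last first.
  rewrite big1 ?mul0r // => j _; rewrite mcoeffZ mcoeffX mn_eq.
  case: eqP => [jp|]; last by rewrite mulr0.
  case: eqP => [jq|]; last by rewrite mulr0.
  by case/eqP: pq; move: (ltn_ord j); lia.
have pn : (p < n.+1)%N by lia.
have qE : q = (n - p)%N by lia.
rewrite (bigD1 (Ordinal pn)) //= big1 => [|j jp]; last first.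
  rewrite mcoeffZ mcoeffX mn_eq; case: eqP => [E|]; last by rewrite mulr0.
  by case/eqP: jp; apply: val_inj.
rewrite addr0 mcoeffZ mcoeffX mn_eq qE !eqxx mulr1 mul1r -(bin_fact (_ :
  p <= n)%N) //.
by rewrite !natrM; field; rewrite !expf_neq0 ?gt_eqF.
Qed.

Lemma quadder_sine_poly n : quadder N (sine_poly n) = 0.
Proof.
apply/mpolyP => m; rewrite mcoeff0 [m]mn_eta; apply: bcoef_eq0.
rewrite bcoef_quadder !bcoef_sine_poly rE !addSn !addnS.
case: (_ == n) => /=; last by rewrite !mul0r mulr0 !addr0.
rewrite !mul1r.
have E := sin_rec (m 0).
transitivity (n`!%:R * (sin ((m 0).+2%:R * th) - 2 * cos th *
  sin ((m 0).+1%:R * th) + sin ((m 0)%:R * th))); first by ring.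
by rewrite E mulr0.
Qed.

Lemma mvdvd_sine_poly n i : sin (n%:R * th) = 0 -> mvdvd i (sine_poly n).
Proof.
move=> sn m mi; rewrite [m]mn_eta; apply: bcoef_eq0; rewrite bcoef_sine_poly.
have [E|] := eqVneq (m 0%R + m 1%R)%N n; last by rewrite mul0r.
case: (ord2P i) mi => -> mi; first by rewrite mi mul0r sin0 !mulr0.
by rewrite mi addn0 in E; rewrite E sn !mulr0.
Qed.

Lemma sine_poly_gt0 n (x : 'rV[R]_2) : (1 < n)%N ->
  (forall j, (0 < j < n)%N -> 0 < sin (j%:R * th)) -> sin (n%:R * th) = 0 ->
  open_orthant x -> 0 < poly_fun (sine_poly n) x.
Proof.
move=> n1 sj sn x0; rewrite /poly_fun /sine_poly raddf_sum /=.
pose c (j : 'I_n.+1) := 'C(n, j)%:R / (s0 ^+ j * s1 ^+ (n - j)) *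
  meval (fun i => x 0 i) (mpolyX R (mn j (n - j))).
have c_gt0 j : 0 < c j.
  apply: mulr_gt0; last first.
    by rewrite mevalX; apply: prodr_gt0 => i _; exact: exprn_gt0.
  apply: divr_gt0; last by apply: mulr_gt0; exact: exprn_gt0.
  by rewrite ltr0n bin_gt0 -ltnS.
have termE (j : 'I_n.+1) : meval (fun i => x 0 i)
    (('C(n, j)%:R * sin (j%:R * th) / (s0 ^+ j * s1 ^+ (n - j))) *:
      mpolyX R (mn j (n - j))) = c j * sin (j%:R * th).
  by rewrite mevalZ /c; set w := _^-1; ring.
have n1' : (1 < n.+1)%N by rewrite ltnS ltnW.
(* The term j = 1 is strictly positive and the others are nonnegative, those for j = 0 and j = n
   being zero. *)
rewrite (eq_bigr _ (fun j _ => termE j)) (bigD1 (Ordinal n1')) //.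
apply: ltr_pwDl; first by apply: mulr_gt0 => //; apply: (sj 1%N).
apply: sumr_ge0 => j _; rewrite mulr_ge0 ?(ltW (c_gt0 j)) //.
have [->|j0] := posnP j; first by rewrite mul0r sin0.
have [jn|jn] := ltnP j n; first by rewrite ltW // sj // j0.
by have -> : j = n :> nat; [move: (ltn_ord j); lia|rewrite sn].
Qed.

End PlanarHarmonicPolynomials.

Lemma pihomog_dominant_eq0 (R : realFieldType) (d : nat) (P : mpoly d R) :
  pihomog mdeg (mmeasure mdeg P).-1 P = 0 -> P = 0.
Proof.
move=> H0; apply/eqP; apply: contraT => P0.
have := congr1 (mcoeff (mlead P)) H0.
rewrite mcoeff0 mcoeff_pihomog -(mlead_deg P0) eqxx => /eqP.
by rewrite mleadc_eq0 (negbTE P0).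
Qed.

(** A point of the closed orthant without zero coordinate has all coordinates positive, and so do
    its neighbours. *)
Lemma boundary_orthant_coord0 (R : realType) (d : nat) (x : 'rV[R]_d) :
  boundary (@orthant R d) x -> exists i, x 0 i = 0.
Proof.
move=> [xcl xint]; apply: contrapT => /forallNP x0.
have orthE : @orthant R d = [set y | forall i, 0 <= (y *m 1%:M) 0 i].
  by apply/seteqP; split=> y yA i; have := yA i; rewrite mulmx1.
have xge : orthant x.
  by move: xcl; rewrite orthE => xcl; exact: (@closed_cone _ _ 1%:M).
have x_gt0 i : \forall y \near x, 0 < (y : 'rV[R]_d) 0 i.
  have xi : 0 < x 0 i by rewrite lt_neqAle xge andbT eq_sym; apply/eqP/x0.
  exact: (coord_continuous (open_nbhs_nbhs (conj (@open_gt _ 0) xi))).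
apply: xint; apply: filterS (filter_forall (nbhs_filter x) x_gt0) => y y0 i.
exact/ltW/y0.
Qed.

(** * Correction of the sine polynomial into a discrete harmonic one *)

Section PlanarExistence.
Variables (R : realType).
Variables (S : {fset 'rV[R]_2}) (a : 'rV[R]_2 -> R).
Hypothesis hcov : posdefmx (covmx S a).
Hypothesis ha_sum1 : \sum_(s <- S) a s = 1.
Hypothesis ha_drift0 : \sum_(s <- S) a s *: s = 0.

Let X01 : mpoly 2 R := mpolyX R (mnm1 0) * mpolyX R (mnm1 1).

Lemma mvdvd_X01M (G : mpoly 2 R) i : mvdvd i (X01 * G).
Proof.
apply: mvdvd_face => v _ vi; rewrite !mevalM !mevalXU.
by move: vi; case: (ord2P i) => -> ->; rewrite ?mul0r ?mulr0 ?mul0r.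
Qed.

Lemma msize_X01M (G : mpoly 2 R) :
  (mmeasure mdeg (X01 * G) <= (mmeasure mdeg G).+2)%N.
Proof.
apply: leq_trans (msizeM_leq _ _) _.
have : (mmeasure mdeg X01 <= 3)%N.
  by apply: leq_trans (msizeM_leq _ _) _; rewrite !msizeX !mdeg1.
by set b := mmeasure _ X01; set c := mmeasure _ G; lia.
Qed.

(* [G |-> mlap (x_0 x_1 G)] is an endomorphism of the polynomials of degree
   < k. It is injective: the dominant term of x_0 x_1 G would be a harmonic
   polynomial of degree at most [k + 1] vanishing on both axes. *)
Lemma mlap_X01M_surj k (Q : mpoly 2 R) :
  (forall j H, (j <= k.+1)%N -> (forall m, mdeg m != j -> mcoeff m H = 0) ->
    (forall i, mvdvd i H) -> quadder (momentmx S a) H = 0 -> H = 0) ->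
  (mmeasure mdeg Q <= k)%N ->
  exists2 G, (mmeasure mdeg G <= k)%N & mlap S a (X01 * G) = Q.
Proof.
move=> noharm Qk; pose I : finType := bmultinom 2 k;
  pose ev (i : 'I_#|I|) : multinom 2 := enum_val i.
have evP m : (mdeg m < k)%N -> exists i, ev i = m.
  move=> mk; exists (enum_rank (BMultinom mk)).
  by rewrite /ev enum_rankK.
have ev_lt i : (mdeg (ev i) < k)%N by exact: bmdeg.
have ev_inj : injective ev by move=> i j /val_inj/enum_val_inj.
have eq_ev (p q : mpoly 2 R) :
  (mmeasure mdeg p <= k)%N -> (mmeasure mdeg q <= k)%N ->
    (forall i, mcoeff (ev i) p = mcoeff (ev i) q) -> p = q.
  move=> pk qk pq; apply/mpolyP => m; have [mk|mk] := ltnP (mdeg m) k.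
    by have [i <-] := evP m mk.
  by rewrite (elimT (msize_leqP _ _) pk) // (elimT (msize_leqP _ _) qk).
pose g (u : 'rV[R]_#|I|) : mpoly 2 R := \sum_i u 0 i *: mpolyX R (ev i).
have gk u : (mmeasure mdeg (g u) <= k)%N.
  apply: leq_trans (mmeasure_sum _ _ _ _) _; apply/bigmax_leqP_seq => i _ _.
  by apply: leq_trans (msizeZ_leq _ _) _; rewrite msizeX.
have gX u : (mmeasure mdeg (X01 * g u) <= k.+2)%N.
  by apply: leq_trans (msize_X01M _) _; rewrite !ltnS.
have g_coef u i : mcoeff (ev i) (g u) = u 0 i.
  rewrite raddf_sum (bigD1 i) //= big1 => [|j ji]; last first.
    by rewrite mcoeffZ mcoeffX (inj_eq ev_inj) (negbTE ji) mulr0.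
  by rewrite mcoeffZ mcoeffX eqxx mulr1 addr0.
(* The matrix of the endomorphism in the basis of monomials of degree less than k, acting on row
   vectors. *)
pose T := \matrix_(i, j) mcoeff (ev j) (mlap S a (X01 * mpolyX R (ev i))).
have lapT u j : mcoeff (ev j) (mlap S a (X01 * g u)) = (u *m T) 0 j.
  rewrite /g mulr_sumr.
  have -> : mlap S a (\sum_i X01 * (u 0 i *: mpolyX R (ev i))) =
      \sum_i u 0 i *: mlap S a (X01 * mpolyX R (ev i)).
    elim/big_rec2: _ => [|i y1 y2 _ <-]; last by rewrite -scalerAr mlapD mlapZ.
    by rewrite -(scale0r (0 : mpoly 2 R)) mlapZ !scale0r.
  by rewrite raddf_sum mxE; apply: eq_bigr => i _; rewrite /= mcoeffZ mxE.
have lapk u : (mmeasure mdeg (mlap S a (X01 * g u)%R) <= k)%N.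
  apply: leq_trans (msize_mlap _ ha_sum1 ha_drift0) _.
  by rewrite leq_subLR; exact: gX.
have uT : T \in unitmx.
  rewrite -row_free_unit -kermx_eq0; apply/rowV0P => u /sub_kermxP uT0.
  have lap0 : mlap S a (X01 * g u) = 0.
    by apply: eq_ev => // [|i]; rewrite ?mmeasure0 // lapT uT0 mxE mcoeff0.
  have X01g : X01 * g u = 0.
    apply: pihomog_dominant_eq0.
    apply: (noharm (mmeasure mdeg (X01 * g u)).-1).
    - by rewrite -subn1 leq_subLR; exact: gX.
    - by move=> m mj; rewrite mcoeff_pihomog (negbTE mj).
    - move=> i m mi; rewrite mcoeff_pihomog; case: ifP => // _.
      exact: (@mvdvd_X01M _ i).
    - exact: mlap_quadder_dominant.
  apply/rowP => i; rewrite mxE -g_coef.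
  (* The factor [X01] takes the value 1 at (1, 1), hence is nonzero. *)
  move/eqP: X01g; rewrite mulf_eq0 => /orP[/eqP X0|/eqP ->];
    last by rewrite mcoeff0.
  have := congr1 (meval (fun=> 1)) X0.
  by rewrite mevalM !mevalXU mulr1 meval0 => /eqP; rewrite oner_eq0.
exists (g ((\row_i mcoeff (ev i) Q) *m invmx T)) => //.
by apply: eq_ev => // i; rewrite lapT mulmxKV // mxE.
Qed.

Lemma exists_aplus_polynomial n : (0 < n)%N ->
  covmx S a 0 1 = - cos (pi / n%:R) -> exists P, aplus_polynomial S a P.
Proof.
move=> n0 covE; pose th : R := pi / n%:R.
have n01 : 0 != 1 :> 'I_2 by [].
have nth : n%:R * th = pi by rewrite mulrC divfK // pnatr_eq0 -lt0n.
(* For n = 1 the correlation would be 1, which definiteness excludes. *)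
have n1 : (1 < n)%N.
  rewrite ltn_neqAle n0 andbT; apply/eqP => E.
  have := cov_bounds hcov n01; rewrite covE -E divr1 cospi !opprK.
  by rewrite ltxx.
have th0 : 0 < th by rewrite divr_gt0 ?pi_gt0 // ltr0n.
have sj j : (0 < j < n)%N -> 0 < sin (j%:R * th).
  move=> /andP[j0 jn]; apply: sin_gt0_pi; rewrite mulr_gt0 ?ltr0n //=.
  by rewrite -nth ltr_pM2r // ltr_nat.
have sn : sin (n%:R * th) = 0 by rewrite nth sinpi.
set s0 := stddev S a 0; set s1 := stddev S a 1; pose r := covmx S a 0 1.
have s0p : 0 < s0 by exact: stddev_gt0.
have s1p : 0 < s1 by exact: stddev_gt0.
have N00 : momentmx S a 0 0 = s0 ^+ 2.
  by rewrite (moment_cov hcov) covmx_diag // mulr1 expr2.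
have N11 : momentmx S a 1 1 = s1 ^+ 2.
  by rewrite (moment_cov hcov) covmx_diag // mulr1 expr2.
have N01 : momentmx S a 0 1 = r * s0 * s1.
  by rewrite (moment_cov hcov) -/r -/s0 -/s1 [r * _]mulrC.
have N10 : momentmx S a 1 0 = r * s0 * s1.
  by rewrite -N01 -[in LHS](momentmx_tr S a) mxE.
pose H := sine_poly s0 s1 th n.
have HN : quadder (momentmx S a) H = 0 by exact:
  (quadder_sine_poly s0p s1p N00 N11 N01 N10 covE).
have Hsz : (mmeasure mdeg H <= n.+1)%N.
  apply/msize_leqP => m nm; rewrite [m]mn_eta; apply: (bcoef_eq0 s0p s1p).
  rewrite bcoef_sine_poly //; case: eqP => [E|]; last by rewrite mul0r.
  by move: nm; rewrite [m]mn_eta mdeg_mn E ltnn.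
have Hlap : (mmeasure mdeg (- mlap S a H) <= n - 2)%N.
  rewrite mmeasureN; have := mlap_quadder_size H ha_sum1 ha_drift0.
  rewrite HN scaler0 subr0 => /leq_trans; apply.
  by rewrite leq_subLR; apply: leq_trans Hsz _; lia.
(* With k = n - 2, harmonic polynomials must be excluded up to degree n - 1, where sin (l th) > 0
   for all relevant l. The correction [X01 * G] then has degree less than n and leaves the dominant
   term H intact. *)
have [|G Gk GE] := @mlap_X01M_surj (n - 2) (- mlap S a H) _ Hlap.
  move=> j K jn Kj Ki KN.
  apply: (homog_quadder_eq0 s0p s1p N00 N11 N01 N10 covE _ Kj Ki KN) => l lj.
  by rewrite gt_eqF // sj; lia.
pose P := H + X01 * G.
have Glt : (mmeasure mdeg (X01 * G) <= n)%N.
  apply: leq_trans (msize_X01M G) (leq_trans (_ : _ <= (n - 2).+2)%N _);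
    last lia.
  by rewrite !ltnS.
have Pn m : mdeg m = n -> mcoeff m P = mcoeff m H.
  move=> mn; rewrite mcoeffD (elimT (msize_leqP _ _) Glt) ?addr0 //.
  by rewrite mn.
(* The coefficient of x_0 x_1^(n-1) is a positive multiple of sin th, so H has degree exactly n. *)
have H1 : mcoeff (mn 1 n.-1) H != 0.
  apply/eqP => E; have := bcoef_sine_poly s0p s1p th n 1 n.-1.
  rewrite /bcoef -/H E mul0r add1n prednK // eqxx mul1r => /esym/eqP.
  rewrite mulf_eq0 pnatr_eq0 -leqn0 leqNgt fact_gt0 /=.
  by rewrite gt_eqF // sj.
have Pm : mmeasure mdeg P = n.+1.
  apply/eqP; rewrite eqn_leq; apply/andP; split.
    apply: leq_trans (mmeasureD_le _ _ _) _; rewrite geq_max Hsz /=.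
    exact: leq_trans Glt (leqnSn _).
  rewrite ltnNge; apply/negP => Pn'; case/eqP: H1.
  have md : mdeg (mn 1 n.-1) = n by rewrite mdeg_mn add1n prednK.
  by rewrite -Pn // (elimT (msize_leqP _ _) Pn') // md.
have Pdom : dominant_term P = H.
  apply/mpolyP => m; rewrite /dominant_term mcoeff_pihomog Pm /=.
  case: eqP => [mn|mn]; first exact: Pn.
  apply/esym; rewrite [m]mn_eta; apply: (bcoef_eq0 s0p s1p).
  rewrite bcoef_sine_poly //; case: eqP => [E|]; last by rewrite mul0r.
  by case: mn; rewrite [m]mn_eta mdeg_mn.
exists P; split.
- by apply/eqP => P0; move: Pm; rewrite P0 mmeasure0.
- move=> x _; rewrite /laplacian /poly_fun -meval_mlap mlapD GE subrr.
  exact: meval0.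
- move=> x /boundary_orthant_coord0[i xi];
  apply: (@mvdvd_meval _ _ i) => // m mi.
  by rewrite mcoeffD (mvdvd_sine_poly s0p s1p sn mi) (mvdvd_X01M G mi) addr0.
- move=> x x0; rewrite Pdom; exact: sine_poly_gt0.
Qed.

End PlanarExistence.

Theorem theorem2 (R : realType) (d : nat) (hd : (2 <= d)%N)
  (S : {fset 'rV[R]_d}) (a : 'rV[R]_d -> R)
  (ha_ge0 : forall s, s \in S -> 0 <= a s)
  (ha_sum1 : \sum_(s <- S) a s = 1)
  (ha_drift0 : \sum_(s <- S) a s *: s = 0)
  (hcov : posdefmx (covmx S a)) :
  ((exists P : mpoly.mpoly d R, aplus_polynomial S a P) ->
     is_weyl_chamber (walk_cone S a))
  /\
  (d = 2%N ->
     (is_weyl_chamber (walk_cone S a) <->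
        forall i j : 'I_d, i != j ->
          exists2 n : nat, (0 < n)%N &
            walk_cone_angle S a i j = pi / n%:R)
     /\
     (is_weyl_chamber (walk_cone S a) ->
        exists P : mpoly.mpoly d R, aplus_polynomial S a P)).
Proof.
have weyl_of_aplus : (exists P, aplus_polynomial S a P) ->
    is_weyl_chamber (walk_cone S a).
  by move=> [P]; exact: aplus_weyl_chamber.
split=> // d2; subst d.
have aplus_of_angle : (forall i j : 'I_2, i != j ->
    exists2 n : nat, (0 < n)%N & walk_cone_angle S a i j = pi / n%:R) ->
    exists P, aplus_polynomial S a P.
  move=> /(_ 0 1 isT)[n n0]; rewrite /walk_cone_angle /angle cone_edges_cos //.
  move=> angleE; apply: (exists_aplus_polynomial hcov ha_sum1 ha_drift0 n0).
  have /andP[c1 c2] := cov_bounds hcov (isT : 0 != 1 :> 'I_2).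
  by rewrite -angleE acosK ?opprK // in_itv /= !ltW.
have angle_of_weyl : is_weyl_chamber (walk_cone S a) -> forall i j : 'I_2,
    i != j -> exists2 n : nat, (0 < n)%N & walk_cone_angle S a i j = pi / n%:R.
  by move=> WC i j ij; exact: weyl_walk_cone_angle.
split; last by move=> /angle_of_weyl; exact: aplus_of_angle.
(* From the angle back to the chamber, the argument goes through the polynomial and part (i). *)
by split=> // /aplus_of_angle; exact: weyl_of_aplus.
Qed.
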